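(* Let $X\sim P$ be a Borel probability measure on $\mathbb{R}^d$ and let $\alpha\in(0,\Pi(P))$ be such that $\mathrm{vol}_d(P_\alpha)>0$. Then: (i) for every non-singular $A\in\mathbb{R}^{d\times d}$, $b\in\mathbb{R}^d$ and $x\in\mathbb{R}^d$, $\mathrm{ID}_\alpha(Ax+b;P_{AX+b})=\mathrm{ID}_\alpha(x;P)$, where $P_{AX+b}$ is the law of $AX+b$; (ii) $P$ is halfspace symmetric about $x\in\mathbb{R}^d$ if and only if $\mathrm{ID}_\alpha(x;P)=(c,1)^\top$ for some $c\ge1/2$; (iii) if $x$ satisfies $\mathrm{HD}(x;P)=\Pi(P)$, then for every $u\in\mathbb{R}^d$ the first component of $\mathrm{ID}_\alpha(x+tu;P)$ is non-increasing and the second component is non-decreasing in $t\ge0$; (iv) for all $c_1,c_2\in\mathbb{R}$ the set $\{x\colon \mathrm{ID}^1_\alpha(x;P)\ge c_1,\ \mathrm{ID}^2_\alpha(x;P)\le c_2\}$ is convex, and it is compact whenever $c_1>0$; (v) $\mathrm{ID}^1_\alpha(\cdot;P)$ is upper semicontinuous, $\mathrm{ID}^2_\alpha(\cdot;P)$ is continuous on $\mathbb{R}^d$, and if $P$ has a density then $\mathrm{ID}_\alpha(\cdot;P)$ is continuous on $\mathbb{R}^d$; (vi) $\sup_{\|x\|\ge r}\mathrm{ID}^1_\alpha(x;P)\to0$ and $\inf_{\|x\|\ge r}\mathrm{ID}^2_\alpha(x;P)\to\infty$ as $r\to\infty$.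
   Context: For a Borel probability measure $P$ on $\mathbb{R}^d$ and $X\sim P$, the halfspace (Tukey) depth is $\mathrm{HD}(x;P)=\inf_{u\in\mathbb{R}^d}\Pr(u^\top X\le u^\top x)$; $\Pi(P)=\sup_{x}\mathrm{HD}(x;P)$; the central region is $P_\delta=\{x\colon\mathrm{HD}(x;P)\ge\delta\}$. For a convex body $K$, $\mathrm{Ill}(x;K)=\mathrm{vol}_d(\mathrm{conv}(K\cup\{x\}))$. The illumination depth is $\mathrm{ID}_\alpha(x;P)=(\mathrm{ID}^1_\alpha(x;P),\mathrm{ID}^2_\alpha(x;P))^\top=(\mathrm{HD}(x;P),\ \mathrm{Ill}(x;P_\alpha)/\mathrm{vol}_d(P_\alpha))^\top$. $P$ is halfspace symmetric about $x$ if every closed halfspace containing $x$ has $P$-probability at least $1/2$. *)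

(* Defs.v *)
From HB Require Import structures.
From mathcomp Require Import all_boot all_order all_algebra.
From mathcomp Require Import all_classical all_reals all_analysis.

Set Implicit Arguments.
Unset Strict Implicit.
Unset Printing Implicit Defensive.

Import Order.TTheory GRing.Theory Num.Theory.
Import numFieldNormedType.Exports.

Local Open Scope classical_set_scope.
Local Open Scope ring_scope.

Definition dotv {R : realType} {d : nat} (u x : 'rV[R]_d) : R :=
  \sum_(i < d) u ord0 i * x ord0 i.

Definition enorm {R : realType} {d : nat} (x : 'rV[R]_d) : R :=
  Num.sqrt (dotv x x).

Definition Borel_Rd (R : realType) (d : nat) :=
  g_sigma_algebraType (open : set (set 'rV[R]_d)).

Definition probfun {R : realType} {d : nat} (P : probability (Borel_Rd R d) R)
  : set 'rV[R]_d -> \bar R := fun B => P B.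

Definition law {R : realType} {d : nat} (mu : set 'rV[R]_d -> \bar R)
  (f : 'rV[R]_d -> 'rV[R]_d) : set 'rV[R]_d -> \bar R :=
  fun B => mu (f @^-1` B).

Definition halfspace_depth {R : realType} {d : nat}
  (mu : set 'rV[R]_d -> \bar R) (x : 'rV[R]_d) : R :=
  fine (ereal_inf [set mu [set y | dotv u y <= dotv u x] | u in [set: 'rV[R]_d]]).

Definition max_depth {R : realType} {d : nat} (mu : set 'rV[R]_d -> \bar R)
  : \bar R :=
  ereal_sup [set (halfspace_depth mu x)%:E | x in [set: 'rV[R]_d]].

Definition central_region {R : realType} {d : nat}
  (mu : set 'rV[R]_d -> \bar R) (delta : R) : set 'rV[R]_d :=
  [set x | delta <= halfspace_depth mu x].

Definition conv {R : realType} {d : nat} (A : set 'rV[R]_d) : set 'rV[R]_d :=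
  [set x | forall C, convex_set C -> A `<=` C -> C x].

Fixpoint iter_int {R : realType} (n : nat) : ('rV[R]_n -> \bar R) -> \bar R :=
  match n with
  | 0 => fun f => f 0
  | n'.+1 => fun f =>
      (\int[@lebesgue_measure R]_(t in [set: R])
         iter_int (fun v : 'rV[R]_n' => f (row_mx (const_mx t : 'rV[R]_1) v)))%E
  end.

(* d-dimensional Lebesgue volume vol_d(A) (for Borel A, by Tonelli). *)
Definition vol {R : realType} {d : nat} (A : set 'rV[R]_d) : \bar R :=
  iter_int (fun x => (\1_A x)%:E).

Definition illumination {R : realType} {d : nat} (x : 'rV[R]_d) (K : set 'rV[R]_d)
  : \bar R := vol (conv (K `|` [set x])).

Definition illum_depth {R : realType} {d : nat} (mu : set 'rV[R]_d -> \bar R)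
  (alpha : R) (x : 'rV[R]_d) : R * R :=
  (halfspace_depth mu x,
   fine (illumination x (central_region mu alpha)) /
   fine (vol (central_region mu alpha))).

Definition halfspace_symmetric {R : realType} {d : nat}
  (mu : set 'rV[R]_d -> \bar R) (x : 'rV[R]_d) : Prop :=
  forall (u : 'rV[R]_d) (c : R), u != 0 -> dotv u x <= c ->
    ((1/2)%:E <= mu [set y | (dotv u y <= c)%R])%E.

Definition upper_semicontinuous {R : realType} {d : nat} (f : 'rV[R]_d -> R) :=
  forall x a, f x < a -> exists2 V, nbhs x V & forall y, V y -> f y < a.

Definition has_density {R : realType} {d : nat} (P : probability (Borel_Rd R d) R)
  : Prop :=
  exists f : Borel_Rd R d -> R,
    [/\ measurable_fun setT f, (forall y, 0 <= f y) &
        forall B : set (Borel_Rd R d), measurable B ->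
          P B = iter_int (fun y => (f y * \1_B y)%:E)].

(* Main.v *)
(* The iterated integral defining the volume is integration against a sigma-finite
   Borel measure that is translation invariant, hence is multiplied by a positive
   constant under an invertible linear map: this gives affine invariance.

   The central region K is compact and convex, as the depth is upper semicontinuous,
   quasiconcave and vanishes at infinity.  The key point is that x |-> vol(conv(K u {x}))
   is convex: moving x along a line in direction e, the hull is a shadow system, and
   its chords parallel to e have lengths convex in the position of x, so that Tonelli
   in coordinates adapted to e applies.  A finite convex function is continuous; being
   minimal on K it increases along rays from a deepest point; and since the hull gains
   the homothetic copy (K + x)/2 when x is far from K, it grows at least linearly.

   With a density, hyperplanes are null, and compactness of the sphere of directions
   makes the depth lower semicontinuous. *)
Require Import Defs.
From HB Require Import structures.
From mathcomp Require Import all_boot all_order all_algebra.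
From mathcomp Require Import all_classical all_reals all_analysis.
From mathcomp Require Import measurable_realfun ring lra.
Import Order.TTheory GRing.Theory Num.Theory.
Import numFieldNormedType.Exports.
Set Implicit Arguments.
Unset Strict Implicit.
Unset Printing Implicit Defensive.
Local Open Scope classical_set_scope.
Local Open Scope ring_scope.

(** * Borel measurability on row vectors *)

Section Borel.
Context {R : realType}.

Lemma open_borel n (U : set 'rV[R]_n) : open U ->
  measurable (U : set (Borel_Rd R n)).
Proof. exact: sub_sigma_algebra. Qed.

Lemma closed_borel n (U : set 'rV[R]_n) : closed U ->
  measurable (U : set (Borel_Rd R n)).
Proof.
move=> cU; rewrite -(setCK U); apply: measurableC.
by apply: open_borel; exact: closed_openC.
Qed.

Lemma continuous_borel_fun n (f : 'rV[R]_n -> R) : continuous f ->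
  measurable_fun [set: Borel_Rd R n] (f : Borel_Rd R n -> R).
Proof.
move=> cf; apply: (measurability _ (measurable_realfun.RGenOpens.measurableE R)).
move=> _ [_ [a [b ->] <-]]; rewrite setTI; apply: open_borel.
by apply: open_comp; [move=> ? _; exact: cf | exact: interval_open].
Qed.

Lemma measurable_coord n (i : 'I_n) :
  measurable_fun [set: Borel_Rd R n] (fun x : Borel_Rd R n => (x : 'rV[R]_n) ord0 i : R).
Proof. by apply: continuous_borel_fun; exact: coord_continuous. Qed.

(* Second countability: an open set is a union of cubes with rational centres. *)
Lemma measurable_fun_rV (d : measure_display) (T : measurableType d) n
    (F : T -> Borel_Rd R n) :
  (forall i, measurable_fun setT (fun t => (F t : 'rV[R]_n) ord0 i)) ->
  measurable_fun setT F.
Proof.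
move=> mF.
have mcube (q : 'rV[rat]_n) (k : nat) :
    measurable (F @^-1` [set y : 'rV[R]_n | forall i,
      `|y ord0 i - ratr (q ord0 i)| < k.+1%:R^-1]).
  rewrite (_ : _ @^-1` _ = \big[setI/setT]_(i < n)
      ((fun t => (F t : 'rV[R]_n) ord0 i) @^-1`
        (ball (ratr (q ord0 i) : R) k.+1%:R^-1))); last first.
    apply/seteqP; split => t /= H.
      by rewrite -bigcap_seq => i _ /=; rewrite /ball/= distrC.
    move=> i; move: H; rewrite -bigcap_seq => /(_ i); rewrite /ball/= distrC.
    by apply; rewrite /= mem_index_enum.
  apply: bigsetI_measurable => i _; rewrite -[X in measurable X]setTI.
  by apply: mF => //; apply: open_measurable; exact: ball_open.
apply: (@measurability _ _ T (Borel_Rd R n) setT F (open : set (set 'rV[R]_n)) erefl) => _ [U oU <-]; rewrite setTI.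
(* Cubes not contained in [U] contribute the empty set, so the union runs over a whole countable
   type. *)
rewrite (_ : F @^-1` U = \bigcup_(qk in [set: 'rV[rat]_n * nat])
   if pselect ([set y : 'rV[R]_n | forall i,
      `|y ord0 i - ratr (qk.1 ord0 i)| < qk.2.+1%:R^-1] `<=` U)
   then F @^-1` [set y : 'rV[R]_n | forall i,
      `|y ord0 i - ratr (qk.1 ord0 i)| < qk.2.+1%:R^-1] else set0).
  apply: countable_bigcupT_measurable => // -[q k] /=.
  by case: pselect => ? /=; [exact: mcube | exact: measurable0].
apply/seteqP; split => [t /= Ut|t [[q k] _]]; last first.
  by case: pselect => //= + H; exact.
have /nbhs_ballP[e e0 eU] := open_nbhs_nbhs (conj oU Ut).
(* Half of [e], because coordinates of two points of one cube differ by less than twice its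
   radius. *)
have [k ke] : exists k : nat, k.+1%:R^-1 < e / 2 :> R.
  by have /ltr_add_invr[k] : 0 < e / 2 by [rewrite divr_gt0]; rewrite add0r; exists k.
have /choice[q hq] : forall i : 'I_n, exists q : rat,
    `|(F t : 'rV[R]_n) ord0 i - ratr q| < k.+1%:R^-1.
  move=> i.
  have [] := @rat_in_itvoo R ((F t : 'rV[R]_n) ord0 i) ((F t : 'rV[R]_n) ord0 i + k.+1%:R^-1).
    by rewrite ltrDl invr_gt0.
  move=> q; rewrite in_itv/= => /andP[h1 h2]; exists q.
  by rewrite distrC ger0_norm ?subr_ge0 ?(ltW h1)// ltrBlDl.
exists (\row_i q i, k) => //=.
case: pselect => /= [_ i|]; first by rewrite mxE.
case=> y /= hy; apply: eU; split=> // i j; rewrite (ord1 i) /ball/=.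
have := hy j; rewrite mxE => hy'.
rewrite (_ : _ - _ = ((F t : 'rV[R]_n) ord0 j - ratr (q j)) - (y ord0 j - ratr (q j))); last by ring.
apply: le_lt_trans (ler_normB _ _) _.
by rewrite (splitr e) ltrD// (lt_trans _ ke).
Qed.

End Borel.

(** * Lebesgue measure in dimension n + 1 from dimension n *)

Section VolumeSucc.
Context {R : realType} (n : nat).
Variable m : {sigma_finite_measure set (Borel_Rd R n) -> \bar R}.

Definition row_cons (p : measurableTypeR R * Borel_Rd R n) : Borel_Rd R n.+1 :=
  row_mx (const_mx p.1 : 'rV[R]_1) (p.2 : 'rV[R]_n).

Definition row_uncons (x : Borel_Rd R n.+1) : measurableTypeR R * Borel_Rd R n :=
  ((x : 'rV[R]_(1 + n)) ord0 ord0, rsubmx (x : 'rV[R]_(1 + n))).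

Lemma row_consK : cancel row_cons row_uncons.
Proof.
move=> [t v]; rewrite /row_cons /row_uncons/= row_mxKr; congr (_, _).
by rewrite mxE; case: splitP => //= j _; rewrite mxE.
Qed.

Lemma measurable_row_cons : measurable_fun setT row_cons.
Proof.
apply: measurable_fun_rV => i.
rewrite -(@fintype.splitK 1 n i); case: (@fintype.split 1 n i) => j /=.
  rewrite (_ : (fun _ => _) = fst) //.
  by apply/funext => -[t v]; rewrite [LHS]row_mxEl mxE.
rewrite (_ : (fun _ => _) = (fun x : Borel_Rd R n => (x : 'rV[R]_n) ord0 j) \o snd).
  by apply: measurableT_comp => //; exact: measurable_coord.
by apply/funext => -[t v]; rewrite [LHS]row_mxEr.
Qed.

Lemma measurable_row_uncons : measurable_fun setT row_uncons.
Proof.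
apply: measurable_fun_pair; first exact: measurable_coord.
apply: measurable_fun_rV => i.
rewrite (_ : (fun _ => _) = (fun x : Borel_Rd R n.+1 => (x : 'rV[R]_n.+1) ord0 (rshift 1 i))).
  exact: measurable_coord.
by apply/funext => x; rewrite mxE.
Qed.

(** The head is glued on with the [row_mx] shape used by [iter_int], so Tonelli on the product gives
    one step of the iterated integral. *)
Definition volume_succ : set (Borel_Rd R n.+1) -> \bar R :=
  pushforward (@lebesgue_measure R \x m)%E row_cons.

Let volume_succ0 : volume_succ set0 = 0%E.
Proof. by rewrite /volume_succ /pushforward preimage_set0 measure0. Qed.

Let volume_succ_ge0 A : (0 <= volume_succ A)%E.
Proof. by rewrite /volume_succ /pushforward measure_ge0. Qed.

Let volume_succ_sigma_additive : semi_sigma_additive volume_succ.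
Proof.
move=> F mF tF mUF; rewrite /volume_succ /pushforward preimage_bigcup.
apply: measure_semi_sigma_additive.
- by move=> i; rewrite -[X in measurable X]setTI; exact: measurable_row_cons.
- apply/trivIsetP => /= i j _ _ ij; rewrite -preimage_setI.
  by move/trivIsetP : tF => /(_ _ _ _ _ ij) ->//; rewrite preimage_set0.
- by rewrite -preimage_bigcup -[X in measurable X]setTI; exact: measurable_row_cons.
Qed.

HB.instance Definition _ := isMeasure.Build _ _ _ volume_succ
  volume_succ0 volume_succ_ge0 volume_succ_sigma_additive.

Let volume_succ_sigma_finite : sigma_finite setT volume_succ.
Proof.
have /sigma_finiteP[F [FT ndF Ffin]] := sigma_finiteT m.
exists (fun k => row_uncons @^-1` (`[- k%:R, k%:R] `*` F k)).
  rewrite -preimage_bigcup; apply/esym; rewrite -subTset => x _ /=.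
  have [k _ Fkx] : (\bigcup_k F k) (row_uncons x).2 by rewrite -FT.
  (* The index must dominate both the one covering the tail and the size of the head; monotonicity
     of [F] lets it grow. *)
  pose t := (row_uncons x).1; exists (maxn k (Num.truncn `|t|).+1) => //; split => /=.
    rewrite in_itv/= -ler_norml; apply: le_trans (ltW (truncnS_gt _)) _.
    by rewrite ler_nat leq_maxr.
  have /subsetPset : (F k <= F (maxn k (Num.truncn `|t|).+1))%O by apply: ndF; exact: leq_maxl.
  exact.
move=> k; have [mFk Fk] := Ffin k.
have mX : measurable (`[- k%:R, k%:R]%classic `*` F k : set (measurableTypeR R * _)).
  by apply: measurableX => //; exact: measurable_itv.
split; first by rewrite -[X in measurable X]setTI; exact: measurable_row_uncons.
rewrite /volume_succ /pushforward -comp_preimage.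
rewrite (_ : row_uncons \o row_cons = id); last by apply/funext; exact: row_consK.
rewrite preimage_id product_measure1E//.
apply: lte_mul_pinfty => //.
have L : lebesgue_measure (`[- k%:R, k%:R]%classic : set R) \is a fin_num.
  by rewrite lebesgue_measure_itv/=; case: ifP.
exact: L.
Qed.

HB.instance Definition _ := Measure_isSigmaFinite.Build _ _ _ volume_succ
  volume_succ_sigma_finite.

Lemma integral_volume_succ (f : Borel_Rd R n.+1 -> \bar R) :
  measurable_fun setT f -> (forall x, 0 <= f x)%E ->
  (\int[volume_succ]_x f x =
   \int[@lebesgue_measure R]_t \int[m]_v f (row_mx (const_mx t : 'rV[R]_1) v))%E.
Proof.
move=> mf f0; rewrite (ge0_integral_pushforward measurable_row_cons)//.
rewrite preimage_setT fubini_tonelli1//.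
  by apply: measurableT_comp mf _; exact: measurable_row_cons.
by move=> x; exact: f0.
Qed.

End VolumeSucc.

(** * The volume as a sigma-finite measure *)

Section Volume.
Context {R : realType}.

(** Induction on the dimension: [iter_int] in dimension 0 is evaluation at 0, hence a Dirac mass,
    and each further dimension is one [volume_succ]. Tonelli and the measure lemmas thereby apply to
    [vol]. *)
Lemma volume_exists n : {m : {sigma_finite_measure set (Borel_Rd R n) -> \bar R} |
  forall f : Borel_Rd R n -> \bar R, measurable_fun setT f -> (forall x, 0 <= f x)%E ->
    iter_int f = (\int[m]_x f x)%E}.
Proof.
apply: cid; elim: n => [|n [m IH]].
  exists (\d_(0 : Borel_Rd R 0))%R => f mf f0 /=.
  by rewrite integral_dirac// diracT mul1e.
exists (volume_succ m) => f mf f0; rewrite integral_volume_succ//=.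
apply: eq_integral => t _; rewrite IH//.
have := measurableT_comp mf (measurableT_comp (@measurable_row_cons R n) (pair1_measurable t)).
exact.
Qed.

Definition volume n : {sigma_finite_measure set (Borel_Rd R n) -> \bar R} :=
  sval (volume_exists n).

Lemma iter_intE n (f : Borel_Rd R n -> \bar R) :
  measurable_fun setT f -> (forall x, 0 <= f x)%E ->
  iter_int f = (\int[volume n]_x f x)%E.
Proof. exact: svalP (volume_exists n) f. Qed.

Lemma volE n (A : set 'rV[R]_n) : measurable (A : set (Borel_Rd R n)) ->
  vol A = volume n A.
Proof.
move=> mA; rewrite /vol (@iter_intE n (fun x => (\1_A x)%:E)) ?integral_indic ?setIT//.
exact/measurable_EFinP.
Qed.

Lemma integral_volumeS n (f : Borel_Rd R n.+1 -> \bar R) :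
  measurable_fun setT f -> (forall x, 0 <= f x)%E ->
  (\int[volume n.+1]_x f x =
   \int[@lebesgue_measure R]_t \int[volume n]_v f (row_mx (const_mx t : 'rV[R]_1) v))%E.
Proof.
move=> mf f0; rewrite -iter_intE//=; apply: eq_integral => t _.
rewrite iter_intE//.
exact: (measurableT_comp mf (measurableT_comp (@measurable_row_cons R n) (pair1_measurable t))).
Qed.

End Volume.

(** * Translation invariance, and the volume of cubes *)

Section VolumeInvariance.
Context {R : realType}.

(** Lebesgue measure is determined by its values on half-open intervals, whose length a translation
    preserves. *)
Lemma lebesgue_integral_shift (c : R) (f : R -> \bar R) :
  measurable_fun [set: R] f -> (forall t, 0 <= f t)%E ->
  (\int[@lebesgue_measure R]_t f (t + c)%R = \int[@lebesgue_measure R]_t f t)%E.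
Proof.
move=> mf f0.
have mc : measurable_fun setT (fun t : measurableTypeR R => t + c : measurableTypeR R).
  exact: measurable_funD.
have := @ge0_integral_pushforward _ _ _ _ _ _ mc lebesgue_measure setT f measurableT mf
  (fun y _ => f0 y).
rewrite preimage_setT => <-.
apply: eq_measure_integral => A mA _ /=.
apply/esym/lebesgue_measure_unique => //= _ [[a b]] _ <-.
rewrite /pushforward (_ : _ @^-1` _ = `](a - c), (b - c)]%classic).
  rewrite !lebesgue_measure_itv/= !lte_fin ltrD2r; case: ifP => // _.
  by rewrite !EFinN -!EFinB; congr EFin; ring.
by apply/seteqP; split=> t/=; rewrite !in_itv/= ltrBlDr lerBrDr.
Qed.

Lemma measurable_row_mx n t (f : Borel_Rd R n.+1 -> \bar R) : measurable_fun setT f ->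
  measurable_fun [set: Borel_Rd R n] (fun v => f (row_mx (const_mx t : 'rV[R]_1) v)).
Proof.
move=> mf.
exact: (measurableT_comp mf (measurableT_comp (@measurable_row_cons R n) (pair1_measurable t))).
Qed.

(** Joint measurability in both vectors is what Tonelli requires in the Haar uniqueness argument
    below. *)
Lemma measurable_linear_pair n (A C : 'M[R]_n) :
  measurable_fun setT (fun p : Borel_Rd R n * Borel_Rd R n =>
    (p.1 : 'rV[R]_n) *m A + (p.2 : 'rV[R]_n) *m C : Borel_Rd R n).
Proof.
apply: measurable_fun_rV => i.
rewrite (_ : (fun _ => _) = (fun p : Borel_Rd R n * Borel_Rd R n =>
  \sum_j (p.1 : 'rV[R]_n) ord0 j * A j i + \sum_j (p.2 : 'rV[R]_n) ord0 j * C j i)).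
  apply: measurable_funD; apply: measurable_sum => j; apply: measurable_funM => //.
    by apply: (@measurableT_comp _ _ _ _ _ _ (fun x : Borel_Rd R n => (x : 'rV[R]_n) ord0 j)) => //;
      exact: measurable_coord.
  by apply: (@measurableT_comp _ _ _ _ _ _ (fun x : Borel_Rd R n => (x : 'rV[R]_n) ord0 j)) => //;
    exact: measurable_coord.
by apply/funext => p; rewrite !mxE.
Qed.

Lemma measurable_affine n (A : 'M[R]_n) (b : 'rV[R]_n) :
  measurable_fun setT (fun x : Borel_Rd R n => (x : 'rV[R]_n) *m A + b : Borel_Rd R n).
Proof.
rewrite (_ : (fun _ => _) = (fun p : Borel_Rd R n * Borel_Rd R n =>
    (p.1 : 'rV[R]_n) *m A + (p.2 : 'rV[R]_n) *m 1%:M : Borel_Rd R n) \o (fun x => (x, b))).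
  by apply: measurableT_comp (measurable_linear_pair _ _) _; exact: pair2_measurable.
by apply/funext => x /=; rewrite mulmx1.
Qed.

Lemma measurable_preimage_affine n (A : 'M[R]_n) (b : 'rV[R]_n) (E : set 'rV[R]_n) :
  measurable (E : set (Borel_Rd R n)) ->
  measurable ([set x | E (x *m A + b)] : set (Borel_Rd R n)).
Proof. by move=> mE; rewrite -[X in measurable X]setTI; exact: measurable_affine. Qed.

(** Induction on the dimension: the tail is shifted under the outer integral, then the head by the
    one-dimensional case. *)
Lemma integral_volume_shift n (a : 'rV[R]_n) (f : Borel_Rd R n -> \bar R) :
  measurable_fun setT f -> (forall x, 0 <= f x)%E ->
  (\int[volume n]_x f ((x : 'rV[R]_n) + a)%R = \int[volume n]_x f x)%E.
Proof.
elim: n a f => [a f mf f0|n IH a f mf f0].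
  by apply: eq_integral => x _; congr f; apply/rowP => -[].
have mfa : measurable_fun setT (fun x : Borel_Rd R n.+1 => f ((x : 'rV[R]_n.+1) + a)).
  rewrite (_ : (fun _ => _) = f \o (fun x : Borel_Rd R n.+1 => (x : 'rV[R]_n.+1) *m 1%:M + a)).
    by apply: measurableT_comp mf _; exact: measurable_affine.
  by apply/funext => x /=; rewrite mulmx1.
rewrite !integral_volumeS//.
pose a' : 'rV[R]_(1 + n) := a.
pose g t := (\int[volume n]_v f (row_mx (const_mx t : 'rV[R]_1) v))%E.
transitivity (\int[@lebesgue_measure R]_t g (t + a ord0 ord0)%R)%E.
  apply: eq_integral => t _; rewrite /g.
  have := IH (rsubmx a') _ (measurable_row_mx (t + a ord0 ord0) mf) (fun v => f0 _).
  move=> <-; apply: eq_integral => v _; congr f.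
  transitivity (row_mx (const_mx t : 'rV[R]_1) v + row_mx (lsubmx a') (rsubmx a')).
    by rewrite hsubmxK.
  rewrite add_row_mx (_ : const_mx t + lsubmx a' = const_mx (t + a ord0 ord0))//.
  by apply/rowP => i; rewrite !mxE; congr (_ + a _ _); apply/val_inj; rewrite /= ord1.
apply: lebesgue_integral_shift => [|t]; last exact: integral_ge0.
have := @measurable_fun_fubini_tonelli_F _ _ (measurableTypeR R) (Borel_Rd R n) R (volume n)
  (f \o (@row_cons R n)) (measurableT_comp mf (@measurable_row_cons R n)) (fun x => f0 _).
exact.
Qed.

Lemma volume_indic n (E : set (Borel_Rd R n)) : measurable E ->
  volume n E = (\int[volume n]_x (\1_E x)%:E)%E.
Proof. by move=> mE; rewrite integral_indic// setIT. Qed.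

Lemma volume_shift n (a : 'rV[R]_n) (E : set 'rV[R]_n) :
  measurable (E : set (Borel_Rd R n)) ->
  volume n [set x | E (x + a)] = volume n E.
Proof.
move=> mE.
have mEa : measurable ([set x | E (x + a)] : set (Borel_Rd R n)).
  have := measurable_preimage_affine 1%:M a mE.
  by congr measurable; apply/funext => x/=; rewrite mulmx1.
rewrite (volume_indic mEa) (volume_indic mE).
by rewrite -(@integral_volume_shift n a (fun x => (\1_E x)%:E))//; exact/measurable_EFinP.
Qed.

Definition box n (M : R) : set 'rV[R]_n := [set x | forall i, - M <= x ord0 i <= M].

Lemma closed_box n M : closed (@box n M).
Proof.
rewrite (_ : box M = \bigcap_(i in setT) ((fun x : 'rV[R]_n => x ord0 i) @^-1` `[- M, M])).
  apply: closed_bigI => i _; apply: closed_comp; last exact: interval_closed.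
  by move=> x _; exact: coord_continuous.
apply/seteqP; split => x /= H i; first by move=> _; rewrite /= in_itv/=.
by have := H i I; rewrite /= in_itv.
Qed.

Lemma measurable_box n M : measurable (box M : set (Borel_Rd R n)).
Proof. by apply: closed_borel; exact: closed_box. Qed.

Let row_mx_head n (t : R) (v : 'rV[R]_n) i :
  (row_mx (const_mx t : 'rV[R]_1) v : 'rV[R]_n.+1) ord0 (@lshift 1 n i) = t.
Proof. by rewrite [LHS]row_mxEl mxE. Qed.

Let row_mx_tail n (t : R) (v : 'rV[R]_n) i :
  (row_mx (const_mx t : 'rV[R]_1) v : 'rV[R]_n.+1) ord0 (@rshift 1 n i) = v ord0 i.
Proof. by rewrite [LHS]row_mxEr. Qed.

Lemma volume_box n (M : R) : 0 <= M -> volume n (box M) = ((M *+ 2) ^+ n)%:E.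
Proof.
move=> M0; elim: n => [|n IH].
  rewrite -volE /vol/=; last exact: measurable_box.
  by rewrite indicE mem_set//= => -[].
have mb k := @measurable_box k M.
rewrite (volume_indic (mb n.+1)) integral_volumeS//; last exact/measurable_EFinP.
transitivity (\int[@lebesgue_measure R]_t (((M *+ 2) ^+ n)%:E * (\1_(`[(- M)%R, M]%classic) t)%:E))%E.
  apply: eq_integral => t _.
  rewrite -IH (volume_indic (mb n)) muleC.
  rewrite -ge0_integralZl//; last exact/measurable_EFinP.
  apply: eq_integral => v _; rewrite -EFinM; congr EFin.
  rewrite !indicE -natrM mulnb; congr (_%:R); congr nat_of_bool.
  apply/idP/andP => [/set_mem H|[/set_mem /= tM /set_mem vM]].
    split; apply/mem_set.
      by have := H (@lshift 1 n ord0); rewrite row_mx_head /= in_itv.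
    by move=> i; have := H (@rshift 1 n i); rewrite row_mx_tail.
  apply/mem_set => i; rewrite -(@fintype.splitK 1 n i).
  case: (@fintype.split 1 n i) => j /=; rewrite ?row_mx_head ?row_mx_tail//.
rewrite ge0_integralZl//; last 2 first.
- by apply/measurable_EFinP; exact: measurable_indic.
- by rewrite lee_fin exprn_ge0// mulrn_wge0.
rewrite integral_indic//= setIT lebesgue_measure_itv/= lte_fin.
case: ltrP => [_|MM]; first by rewrite -EFinB -EFinM exprSr opprK mulr2n.
have -> : M = 0 by lra.
by rewrite mule0 mul0rn expr0n.
Qed.



End VolumeInvariance.

(** * The volume under invertible linear maps *)

Section VolumeLinear.
Context {R : realType}.

(* Uniqueness of Haar measure: both sides are the integral of 1_E(x) 1_F(x - y A)
   over (x, y), by Tonelli and translation invariance. *)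
Lemma volume_mulmx_swap n (A : 'M[R]_n) (E F : set 'rV[R]_n) : A \in unitmx ->
  measurable (E : set (Borel_Rd R n)) -> measurable (F : set (Borel_Rd R n)) ->
  (volume n E * volume n [set y | F (- (y *m A))%R] =
   volume n F * volume n [set y | E (y *m A)%R])%E.
Proof.
move=> uA mE mF.
have mpre (G : set 'rV[R]_n) (C : 'M[R]_n) b : measurable (G : set (Borel_Rd R n)) ->
    measurable ([set y | G (y *m C + b)] : set (Borel_Rd R n)).
  by move=> mG; exact: measurable_preimage_affine.
have mFn : measurable ([set y | F (- (y *m A))%R] : set (Borel_Rd R n)).
  have := mpre F (- A) 0 mF.
  by congr measurable; apply/funext => y /=; rewrite addr0 mulmxN.
have mEA : measurable ([set y | E (y *m A)] : set (Borel_Rd R n)).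
  have := mpre E A 0 mE.
  by congr measurable; apply/funext => y /=; rewrite addr0.
pose I2 (G H : set 'rV[R]_n) (C : 'M[R]_n) (p : Borel_Rd R n * Borel_Rd R n) : \bar R :=
  ((\1_G p.1)%:E * (\1_H ((p.1 : 'rV[R]_n) *m 1%:M + (p.2 : 'rV[R]_n) *m C))%:E)%E.
have I2m G H C : measurable (G : set (Borel_Rd R n)) -> measurable (H : set (Borel_Rd R n)) ->
    measurable_fun setT (I2 G H C).
  move=> mG mH; apply: emeasurable_funM.
    apply/measurable_EFinP; apply: (@measurableT_comp _ _ _ _ _ _ (\1_G : Borel_Rd R n -> R)) => //.
  apply/measurable_EFinP; apply: (@measurableT_comp _ _ _ _ _ _ (\1_H : Borel_Rd R n -> R)) => //.
  exact: measurable_linear_pair.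
have I20 G H C p : (0 <= I2 G H C p)%E by rewrite /I2 -EFinM lee_fin mulr_ge0.
have inner (G H : set 'rV[R]_n) C x : C \in unitmx ->
    measurable (H : set (Borel_Rd R n)) ->
    measurable ([set y | H (y *m C)] : set (Borel_Rd R n)) ->
    (\int[volume n]_y I2 G H C (x, y) = (\1_G x)%:E * volume n [set y | H (y *m C)])%E.
  move=> uC mH mHC; rewrite (volume_indic mHC).
  (* Translating [y] by x C^-1 absorbs [x], so the inner integral depends on [x] only through the
     indicator of [G]. *)
  rewrite -(@integral_volume_shift R n (x *m invmx C) 
    (fun y => (\1_[set y | H (y *m C)] y)%:E))//; last exact/measurable_EFinP.
  rewrite -ge0_integralZl//; last first.
    apply/measurable_EFinP.
    rewrite (_ : (fun _ => _) = (\1_[set y | H (y *m C)] : Borel_Rd R n -> R) \o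
        (fun y : Borel_Rd R n => (y : 'rV[R]_n) *m 1%:M + x *m invmx C)).
      by apply: measurableT_comp => //; exact: measurable_affine.
    by apply/funext => y /=; rewrite mulmx1.
  apply: eq_integral => y _; rewrite /I2/= !indicE; congr (_ * (_ : R)%:E)%E.
  congr (nat_of_bool _)%:R; apply/idP/idP => /set_mem/= h; apply/mem_set => /=; move: h;
    by rewrite mulmxDl mulmxKV// mulmx1 addrC.
have uAN : - A \in unitmx by rewrite -scaleN1r unitmxZ// unitrN1.
have FE : [set y | F (y *m - A)] = [set y | F (- (y *m A))%R].
  by apply/funext => y /=; rewrite mulmxN.
transitivity (\int[volume n]_x \int[volume n]_y I2 E F (- A)%R (x, y))%E.
  under eq_integral do rewrite inner ?FE//.
  under eq_integral do rewrite muleC.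
  by rewrite ge0_integralZl ?(volume_indic mE) 1?muleC//; exact/measurable_EFinP.
rewrite (fubini_tonelli (I2 E F (- A)))//; last exact: I2m.
transitivity (\int[volume n]_y \int[volume n]_x I2 F E A (x, y))%E; last first.
  rewrite -(fubini_tonelli (I2 F E A))//; last exact: I2m.
  under eq_integral do rewrite inner//.
  under eq_integral do rewrite muleC.
  by rewrite ge0_integralZl ?(volume_indic mF) 1?muleC//; exact/measurable_EFinP.
apply: eq_integral => y _.
(* For fixed [y], translating [x] by y A exchanges the roles of [E] and [F]. *)
rewrite -(@integral_volume_shift R n (y *m A) (fun x => I2 E F (- A) (x, y)))//; last first.
  by apply: (measurableT_comp (I2m E F (- A) mE mF)); exact: pair2_measurable.
apply: eq_integral => x _; rewrite /I2/= muleC !mulmx1; congr (_ * _)%E.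
by rewrite mulmxN addrK.
Qed.

(* The constant is 1 / |det A|, but only its positivity is needed. *)
Lemma volume_mulmx n (A : 'M[R]_n) : A \in unitmx ->
  exists2 c : R, 0 < c & forall E : set 'rV[R]_n, measurable (E : set (Borel_Rd R n)) ->
    volume n [set x | E (x *m A)] = (c%:E * volume n E)%E.
Proof.
move=> uA.
(* The unit cube normalises the swap identity: one factor becomes 1, the other the constant. *)
pose Q : set 'rV[R]_n := box 2^-1.
have mQ : measurable (Q : set (Borel_Rd R n)) by exact: measurable_box.
have Q1 : volume n Q = 1%E.
  rewrite volume_box ?invr_ge0//; congr EFin.
  by rewrite -(mulr_natr 2^-1) mulVf ?pnatr_eq0// expr1n.
have cE E (mE : measurable (E : set (Borel_Rd R n))) := volume_mulmx_swap uA mE mQ.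
set c := volume n [set y | Q (- (y *m A))] in cE.
have {}cE E : measurable (E : set (Borel_Rd R n)) ->
    volume n [set x | E (x *m A)] = (c * volume n E)%E.
  by move=> mE; have := cE E mE; rewrite Q1 mul1e muleC.
have c0 : (0 <= c)%E by exact: measure_ge0.
(* Testing on the image of the cube under [A] gives 1 = c vol(QA), which rules out both c = 0 and c
   = +oo. *)
have E1 := cE [set x | Q (x *m invmx A)].
have mE : measurable ([set x | Q (x *m invmx A)] : set (Borel_Rd R n)).
  have := measurable_preimage_affine (invmx A) 0 mQ.
  by congr measurable; apply/funext => y /=; rewrite addr0.
have {E1} := E1 mE.
rewrite (_ : [set x | _] = Q); last by apply/funext => x /=; rewrite mulmxK.
rewrite Q1; case: c c0 cE => [c|_ _|//]; last first.
  have := measure_ge0 (volume n) [set x | Q (x *m invmx A)].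
  rewrite le_eqVlt => /orP[/eqP <-|h]; first by rewrite mule0 => /eqP; rewrite onee_eq0.
  by rewrite gt0_mulye.
rewrite lee_fin le_eqVlt => /orP[/eqP <- _|c0 cE _]; last by exists c.
by rewrite mul0e => /eqP; rewrite onee_eq0.
Qed.

End VolumeLinear.

(** * Hulls of a convex set and a point; compact sets *)

Section ConvexHull.
Context {R : realType} {n : nat}.
Implicit Types (K C : set 'rV[R]_n) (x y : 'rV[R]_n) (t : R).

Lemma convex_setP C : convex_set C <->
  forall x y t, 0 <= t -> t <= 1 -> C x -> C y -> C ((1 - t) *: x + t *: y).
Proof.
split=> [cC x y t t0 t1 Cx Cy|cC x y l /set_mem Cx /set_mem Cy].
  have := cC y x (Itv01 t0 t1) (mem_set Cy) (mem_set Cx) => /set_mem.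
  by rewrite addrC.
apply/mem_set.
have := cC y x l%:num; rewrite addrC; apply => //.
Qed.

(** For convex nonempty [K] this is the convex hull of [K] and [x], parametrised by a base point in
    [K] and the weight of the apex. *)
Definition join K x : set 'rV[R]_n :=
  [set y | exists k t, [/\ K k, 0 <= t, t <= 1 & y = (1 - t) *: k + t *: x]].

Lemma sub_join K x : K `<=` join K x.
Proof. by move=> k Kk; exists k, 0; split=> //; rewrite subr0 scale1r scale0r addr0. Qed.

Lemma join_apex K x : K !=set0 -> join K x x.
Proof. by move=> [k Kk]; exists k, 1; split=> //; rewrite subrr scale1r scale0r add0r. Qed.

Lemma convex_join K x : convex_set K -> convex_set (join K x).
Proof.
move=> /convex_setP cK; apply/convex_setP => _ _ t t0 t1 [k [a [Kk a0 a1 ->]]] [l [b [Kl b0 b1 ->]]].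
(* [s] is the total weight of the apex; the remaining weight is shared by the two base points, whose
   normalised combination stays in [K]. *)
pose s := (1 - t) * a + t * b.
have s0 : 0 <= s by rewrite addr_ge0// mulr_ge0// subr_ge0.
have s1 : s <= 1 by rewrite /s; nra.
(* Normalising would divide by zero at s = 1, but there both base points have weight zero. *)
have [s1E|s1N] := eqVneq s 1.
  exists k, 1; split => //.
  have [ta tb] : (1 - t) * (1 - a) = 0 /\ t * (1 - b) = 0.
    by move: s1E; rewrite /s => s1E; split; nra.
  rewrite !scalerDr !scalerA ta tb subrr !scale0r !add0r -scalerDl.
  by rewrite -/s s1E.
have s1' : 0 < 1 - s by rewrite subr_gt0 lt_neqAle s1N.
pose r := t * (1 - b) / (1 - s).
exists ((1 - r) *: k + r *: l), s; split => //.
  apply: cK => //; first by rewrite divr_ge0 ?mulr_ge0 ?subr_ge0.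
  by rewrite ler_pdivrMr// mul1r /s; nra.
rewrite !scalerDr !scalerA.
have -> : (1 - s) * r = t * (1 - b) by rewrite /r; field; rewrite gt_eqF.
have -> : (1 - s) * (1 - r) = (1 - t) * (1 - a) by rewrite /r /s; field; rewrite gt_eqF.
rewrite /s scalerDl !addrA; congr (_ + _); rewrite -!addrA; congr (_ + _).
exact: addrC.
Qed.

Lemma conv_setU1 K x : convex_set K -> K !=set0 -> Defs.conv (K `|` [set x]) = join K x.
Proof.
move=> cK K0; apply/seteqP; split => y.
  move/(_ (join K x) (@convex_join K x cK)); apply => z [/sub_join|/= ->]; first exact.
  exact: join_apex.
move=> [k [t [Kk t0 t1 ->]]] C /convex_setP cC KC; apply: cC => //; apply: KC; by [left|right].
Qed.

Lemma compact_join K x : compact K -> compact (join K x).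
Proof.
move=> cK.
pose f (p : 'rV[R]_n * R) : 'rV[R]_n := (1 - p.2) *: p.1 + p.2 *: x.
rewrite (_ : join K x = f @` (K `*` `[0, 1]%classic)).
  apply: continuous_compact; last by apply: compact_setX => //; exact: segment_compact.
  apply: continuous_subspaceT => p; apply: cvgD.
    apply: cvgZ; last exact: cvg_fst.
    by apply: cvgB; [exact: cvg_cst|exact: cvg_snd].
  by apply: cvgZ; [exact: cvg_snd|exact: cvg_cst].
apply/seteqP; split => y.
  by move=> [k [t [Kk t0 t1 ->]]]; exists (k, t) => //; split => //=; rewrite in_itv/= t0 t1.
by move=> [[k t] [/= Kk]]; rewrite in_itv/= => /andP[t0 t1] <-; exists k, t.
Qed.

Lemma compact_borel K : compact K -> measurable (K : set (Borel_Rd R n)).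
Proof. by move=> cK; apply: closed_borel; apply: compact_closed => //; exact: norm_hausdorff. Qed.

Lemma normr_coord x (i : 'I_n) : `|x ord0 i| <= `|x|.
Proof.
rewrite {2}/Num.norm/= mx_normrE.
exact: (@le_bigmax_cond _ _ _ _ (ord0, i) (fun=> true) (fun ij : 'I_1 * 'I_n => `|x ij.1 ij.2|)).
Qed.

Lemma bounded_set_normP K : bounded_set K <-> exists2 M, 0 < M & forall x, K x -> `|x| <= M.
Proof.
split=> [[M0 [_ H]]|[M M0 H]].
  exists (`|M0| + 1); first by rewrite ltr_wpDl.
  by move=> x Kx; apply: H => //; rewrite (le_lt_trans (ler_norm _))// ltrDl.
by exists M; split; [exact: num_real|move=> N MN x Kx; apply: le_trans (H _ Kx) (ltW MN)].
Qed.

Lemma compact_sub_box K : compact K -> exists2 M, 0 < M & K `<=` box M.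
Proof.
move=> /compact_bounded/bounded_set_normP[M M0 KM]; exists M => // x Kx i.
by rewrite -ler_norml (le_trans (normr_coord _ _))// KM.
Qed.

Lemma volume_compact_fin K : compact K -> volume n K \is a fin_num.
Proof.
move=> cK; rewrite ge0_fin_numE//.
have [M M0 KM] := compact_sub_box cK.
apply: (@le_lt_trans _ _ (volume n (box M))).
  by apply: le_measure => //; rewrite inE; [exact: compact_borel|exact: measurable_box].
by rewrite volume_box ?ltry// ltW.
Qed.

End ConvexHull.

(** * Chords parallel to the first axis, and adapted coordinates *)

Section Fibres.
Context {R : realType} {n : nat}.

Definition fibre (E : set 'rV[R]_n.+1) (v : 'rV[R]_n) : set R :=
  [set t | E (row_mx (const_mx t : 'rV[R]_1) v)].

Lemma measurable_fibre E v : measurable (E : set (Borel_Rd R n.+1)) ->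
  measurable (fibre E v : set (measurableTypeR R)).
Proof.
move=> mE.
have := measurableT_comp (@measurable_row_cons R n) (@pair2_measurable _ _ (measurableTypeR R) (Borel_Rd R n) v).
by move=> /(_ measurableT _ mE); rewrite setTI.
Qed.

Let ysection_fibre (E : set (Borel_Rd R n.+1)) (v : Borel_Rd R n) :
  ysection (@row_cons R n @^-1` E) v = fibre E v.
Proof. by apply/seteqP; split=> t /=; rewrite /ysection/= inE. Qed.

Let measurable_row_cons_preimage (E : set (Borel_Rd R n.+1)) : measurable E ->
  measurable (@row_cons R n @^-1` E).
Proof. by move=> mE; rewrite -[X in measurable X]setTI; exact: measurable_row_cons. Qed.

Lemma measurable_fibre_length E : measurable (E : set (Borel_Rd R n.+1)) ->
  measurable_fun [set: Borel_Rd R n] (fun v => @lebesgue_measure R (fibre E v)).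
Proof.
move=> mE; have := measurable_fun_ysection (@lebesgue_measure R) (measurable_row_cons_preimage mE).
by congr measurable_fun; apply/funext => v /=; rewrite ysection_fibre.
Qed.

(** [iter_int] puts the first coordinate outermost; Tonelli moves it inside, leaving an integral of
    chord lengths. *)
Lemma volume_fibre E : measurable (E : set (Borel_Rd R n.+1)) ->
  volume n.+1 E = (\int[volume n]_v @lebesgue_measure R (fibre E v))%E.
Proof.
move=> mE; rewrite volume_indic// integral_volumeS//; last exact/measurable_EFinP.
have mE' := measurable_row_cons_preimage mE.
have f0 z : (0 <= (EFin \o \1_(@row_cons R n @^-1` E)) z :> \bar R)%E by rewrite lee_fin.
apply: etrans (@fubini_tonelli _ _ _ _ R (@lebesgue_measure R) (volume n) _ _ f0) _.
  exact/measurable_EFinP.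
apply: eq_integral => v _.
have := @integral_indic _ _ R (@lebesgue_measure R) setT measurableT _ (measurable_fibre v mE).
by rewrite setIT => <-.
Qed.

(** A nonempty set of bounded diameter lies between its infimum and supremum. [C] is an extended
    real because it will be a combination of chord lengths. *)
Lemma lebesgue_measure_le_diam (A : set R) (C : \bar R) :
  measurable (A : set (measurableTypeR R)) -> (0 <= C)%E ->
  (forall p q, A p -> A q -> (q - p)%:E <= C)%E -> (@lebesgue_measure R A <= C)%E.
Proof.
move=> mA C0 AC.
have [->|/set0P[a Aa]] := eqVneq A set0; first by rewrite measure0.
case: C C0 AC => [C|_ _|//]; last by rewrite leey.
rewrite lee_fin => C0 AC.
have {}AC p q : A p -> A q -> q <= p + C.
  by move=> Ap Aq; have := AC p q Ap Aq; rewrite lee_fin lerBlDl.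
have A0 : A !=set0 by exists a.
have hu : has_ubound A by exists (a + C) => q; exact: AC.
have hl : has_lbound A by exists (a - C) => p Ap; rewrite lerBlDr; exact: AC.
have sub : A `<=` `[inf A, sup A]%classic.
  by move=> p Ap; rewrite /= in_itv/= ge_inf// ub_le_sup.
apply: (@le_trans _ _ (@lebesgue_measure R `[inf A, sup A]%classic)).
  by apply: le_measure => //; rewrite inE.
rewrite lebesgue_measure_itv/= lte_fin; case: ifP => // _.
rewrite -EFinB lee_fin lerBlDl -lerBlDr; apply: lb_le_inf => // p Ap.
by rewrite lerBlDr; apply: ge_sup => // q Aq; exact: AC.
Qed.

Lemma line_coordinates (u : 'rV[R]_n.+1) : u != 0 ->
  exists2 A : 'M[R]_n.+1, A \in unitmx & forall (v : 'rV[R]_n) t r,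
    (row_mx (const_mx (t + r) : 'rV[R]_1) v : 'rV[R]_n.+1) *m A =
    (row_mx (const_mx t : 'rV[R]_1) v : 'rV[R]_n.+1) *m A + r *: u.
Proof.
move=> u0.
(* Gaussian elimination writes [u] as a nonzero scalar times the first basis vector times an
   invertible matrix; the scalar is put into [A]. *)
have uE := mulmx_ebase u; rewrite rank_rV u0 in uE.
have := col_ebase_unit u; set a := col_ebase u in uE *.
rewrite (mx11_scalar a) unitmxE det_scalar expr1 => ua.
exists (a ord0 ord0 *: row_ebase u); first by rewrite unitmxZ// row_ebase_unit.
have uB : u = (pid_mx 1 : 'rV[R]_n.+1) *m (a ord0 ord0 *: row_ebase u).
  by rewrite -[LHS]uE [in LHS](mx11_scalar a) mul_scalar_mx -scalemxAl scalemxAr.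
move=> v t r; rewrite [X in _ = _ + r *: X]uB scalemxAl -mulmxDl; congr (_ *m _).
transitivity (row_mx (const_mx t) v + r *: row_mx 1%:M 0 : 'rV[R]_(1 + n)); last first.
  by rewrite -pid_mx_row.
rewrite scale_row_mx scaler0 add_row_mx addr0.
rewrite (_ : const_mx (t + r) = const_mx t + r *: 1%:M)//.
by apply/rowP => i; rewrite !mxE !ord1 eqxx mulr1.
Qed.

End Fibres.

(** * Convexity of the illumination in the apex *)

Section IlluminationConvex.
Context {R : realType} {n : nat} (K : set 'rV[R]_n.+1).
Hypotheses (cptK : compact K) (cvxK : convex_set K) (K0 : K !=set0).

Definition ill (x : 'rV[R]_n.+1) : R := fine (volume n.+1 (join K x)).

Lemma measurable_join x : measurable (join K x : set (Borel_Rd R n.+1)).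
Proof. by apply: compact_borel; exact: compact_join. Qed.

Lemma volume_join x : volume n.+1 (join K x) = (ill x)%:E.
Proof. by rewrite fineK//; apply: volume_compact_fin; exact: compact_join. Qed.

Lemma illuminationE x : illumination x K = (ill x)%:E.
Proof. by rewrite /illumination conv_setU1// volE ?volume_join//; exact: measurable_join. Qed.

Lemma volume_fine : volume n.+1 K = (fine (volume n.+1 K))%:E.
Proof. by rewrite fineK// volume_compact_fin. Qed.

Lemma ill_ge x : fine (volume n.+1 K) <= ill x.
Proof.
rewrite -lee_fin -volume_join -volume_fine; apply: le_measure; rewrite ?inE.
- exact: compact_borel.
- exact: measurable_join.
- exact: sub_join.
Qed.

Lemma ill_id x : K x -> ill x = fine (volume n.+1 K).
Proof.
move=> Kx; rewrite /ill; congr (fine (volume _ _)); apply/seteqP; split.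
  move=> _ [k [t [Kk t0 t1 ->]]]; exact/(proj1 (convex_setP _) cvxK).
exact: sub_join.
Qed.

Let interval_length (F : set R) a b : measurable (F : set (measurableTypeR R)) ->
  (forall m, a <= m <= b -> F m) -> ((b - a)%:E <= @lebesgue_measure R F)%E.
Proof.
move=> mF Fab; have [ab|ba] := leP a b; last first.
  by apply: (@le_trans _ _ 0%E) => //; rewrite lee_fin subr_le0 ltW.
have : (@lebesgue_measure R `[a, b]%classic <= @lebesgue_measure R F)%E.
  apply: le_measure => //; rewrite ?inE// => m /=; rewrite in_itv/=; exact: Fab.
apply: le_trans; rewrite lebesgue_measure_itv/= lte_fin -EFinB; case: ltrP => // ba.
by rewrite lee_fin subr_le0.
Qed.

(* The hulls of K with x, z and y (z between x and y) are swept out by the same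
   chords parallel to y - x, with apexes moving affinely: this is a shadow system. *)
Lemma ill_convex x y l : 0 <= l -> l <= 1 ->
  ill ((1 - l) *: x + l *: y) <= (1 - l) * ill x + l * ill y.
Proof.
move=> l0 l1; have [->|xy] := eqVneq x y.
  by rewrite -scalerDl -mulrDl subrK scale1r mul1r.
set z := _ + _.
have u0 : y - x != 0 by rewrite subr_eq0 eq_sym.
have [A uA Au] := line_coordinates u0.
have [c c0 cE] := volume_mulmx uA.
pose T w : set 'rV[R]_n.+1 := [set q | join K w (q *m A)].
have mT w : measurable (T w : set (Borel_Rd R n.+1)).
  have := measurable_preimage_affine A 0 (measurable_join w).
  by congr measurable; apply/funext => q /=; rewrite addr0.
have TE w : volume n.+1 (T w) = (c * ill w)%:E.
  by rewrite cE ?volume_join//; exact: measurable_join.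
(* Chords of the convex set [T w] are intervals; [th] is the relative position of [m] between the
   ends. *)
have fibre_itv w v a b m : fibre (T w) v a -> fibre (T w) v b -> a <= m <= b ->
    fibre (T w) v m.
  rewrite /fibre /T/= => Fa Fb /andP[am mb].
  have [ab|ab] := eqVneq a b.
    by have -> : m = a by apply/eqP; rewrite eq_le am ab mb.
  have ab0 : 0 < b - a by rewrite subr_gt0 lt_neqAle ab (le_trans am).
  pose th := (m - a) / (b - a).
  have -> : m = a + th * (b - a) by rewrite /th; field; rewrite gt_eqF.
  have bE := Au v a (b - a); rewrite addrC subrK in bE.
  have := proj1 (convex_setP _) (@convex_join _ _ K w cvxK) _ _ th _ _ Fa Fb.
  rewrite bE Au scalerDr addrA -scalerDl subrK scale1r scalerA; apply.
  - by apply: divr_ge0; [rewrite subr_ge0|exact: ltW].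
  - by rewrite ler_pdivrMr// mul1r lerD2r.
(* Tonelli reduces the inequality of volumes to one of chord lengths over each [v]. *)
have key : (volume n.+1 (T z) <= (1 - l)%:E * volume n.+1 (T x) + l%:E * volume n.+1 (T y))%E.
  rewrite !volume_fibre//.
  have mL w := measurable_fibre_length (mT w).
  rewrite -!ge0_integralZl ?lee_fin ?subr_ge0//.
  rewrite -ge0_integralD//; last 4 first.
  - by move=> v _; rewrite mule_ge0// lee_fin subr_ge0.
  - exact: emeasurable_funM.
  - by move=> v _; rewrite mule_ge0// lee_fin.
  - exact: emeasurable_funM.
  apply: ge0_le_integral => //.
  - by apply: emeasurable_funD; exact: emeasurable_funM.
  move=> v _; apply: lebesgue_measure_le_diam; first exact: measurable_fibre.
    by rewrite adde_ge0// mule_ge0// lee_fin ?subr_ge0.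
  move=> p q.
  (* Keeping the base point [k] and the weight [s] while the apex goes from [z] to [x] or [y] moves
     the point by -s l or s (1 - l) times y - x. *)
  have split_pt r : fibre (T z) v r -> exists r0 r1,
      [/\ fibre (T x) v r0, fibre (T y) v r1 & r = (1 - l) * r0 + l * r1].
    move=> [k [s [Kk s0 s1 rE]]]; exists (r - s * l), (r + s * (1 - l)).
    split; last by ring.
      exists k, s; split => //; rewrite -mulNr Au rE -addrA; congr (_ + _).
      by rewrite /z; apply/rowP => i; rewrite !mxE; ring.
    exists k, s; split => //; rewrite Au rE -addrA; congr (_ + _).
    by rewrite /z; apply/rowP => i; rewrite !mxE; ring.
  move=> /split_pt[p0 [p1 [hp0 hp1 ->]]] /split_pt[q0 [q1 [hq0 hq1 ->]]].
  rewrite (_ : _ - _ = (1 - l) * (q0 - p0) + l * (q1 - p1)); last by ring.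
  rewrite EFinD !EFinM; apply: leeD.
    apply: lee_wpmul2l; first by rewrite lee_fin subr_ge0.
    by apply: interval_length => [|m pm]; [exact: measurable_fibre|exact: fibre_itv pm].
  apply: lee_wpmul2l; first by rewrite lee_fin.
  by apply: interval_length => [|m pm]; [exact: measurable_fibre|exact: fibre_itv pm].
move: key; rewrite !TE -!EFinM -EFinD lee_fin => key.
rewrite -(ler_pM2l c0); apply: le_trans key _; rewrite le_eqVlt; apply/orP; left; apply/eqP; ring.
Qed.

End IlluminationConvex.

(** * Continuity of convex functions bounded above on balls *)

Section ConvexContinuous.
Context {R : realType} {V : normedModType R}.

(** The bound [B] gives a Lipschitz estimate at [x] with constant B - f x: convexity towards the
    unit sphere around [x] bounds [f] from above, and the antipodal point bounds it from below. *)
Lemma convex_locally_bounded_continuous (f : V -> R) :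
  (forall x y t, 0 <= t -> t <= 1 -> f ((1 - t) *: x + t *: y) <= (1 - t) * f x + t * f y) ->
  (forall M, exists B, forall x, `|x| <= M -> f x <= B) ->
  continuous f.
Proof.
move=> cf bf x; have [B hB] := bf (`|x| + 1).
have near1 z : `|z| = 1 -> f (x + z) <= B.
  by move=> z1; apply: hB; rewrite (le_trans (ler_normD _ _))// z1.
have Bx : f x <= B by apply: hB; rewrite lerDl.
have lip h : `|h| < 1 -> `|f x - f (x + h)| <= `|h| * (B - f x).
  have [->|h0] := eqVneq h 0; first by rewrite addr0 subrr !normr0 mul0r.
  move=> h1; set t := `|h|; have t0 : 0 < t by rewrite normr_gt0.
  have tN0 : t != 0 by rewrite gt_eqF.
  have z1 : `|t^-1 *: h| = 1 by rewrite normrZ gtr0_norm ?invr_gt0// mulVf.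
  have up := cf x (x + t^-1 *: h) t (ltW t0) (ltW h1).
  have tp0 : 0 < 1 + t by rewrite addr_gt0.
  have tp : 1 + t != 0 by rewrite gt_eqF.
  (* [x] splits the segment from x + h to the antipodal point x - h / t into lengths t and 1, whence
     the weight. *)
  have lo := cf (x + h) (x - t^-1 *: h) (t / (1 + t)).
  have e1 : (1 - t) *: x + t *: (x + t^-1 *: h) = x + h.
    by rewrite scalerDr scalerA divff// scale1r addrA -scalerDl subrK scale1r.
  have e2 : (1 - t / (1 + t)) *: (x + h) + (t / (1 + t)) *: (x - t^-1 *: h) = x.
    have -> : 1 - t / (1 + t) = (1 + t)^-1 by field.
    rewrite !scalerDr addrACA -scalerDl scalerN scalerA.
    have -> : (1 + t)^-1 + t / (1 + t) = 1 by field.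
    have -> : t / (1 + t) * t^-1 = (1 + t)^-1 by field; rewrite tN0 tp.
    by rewrite subrr addr0 scale1r.
  rewrite e1 in up; rewrite e2 in lo.
  have b1 := near1 _ z1.
  have b2 : f (x - t^-1 *: h) <= B by apply: near1; rewrite normrN.
  have q0 : 0 <= t / (1 + t) by rewrite divr_ge0// ltW.
  have q1 : t / (1 + t) <= 1 by rewrite ler_pdivrMr// mul1r lerDr.
  have {lo} := lo q0 q1.
  have -> : 1 - t / (1 + t) = (1 + t)^-1 by field.
  rewrite -(ler_pM2l tp0).
  have -> a b : (1 + t) * ((1 + t)^-1 * a + t / (1 + t) * b) = a + t * b by field.
  move=> lo.
  by rewrite ler_norml; apply/andP; split; nra.
apply/cvgrPdist_lt => e e0.
(* The summand 1 keeps the denominator positive when f x = B. *)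
pose d := Num.min 1 (e / (B - f x + 1)).
have C0 : 0 < B - f x + 1 by rewrite ltr_wpDl// subr_ge0.
have d0 : 0 < d by rewrite lt_min ltr01 divr_gt0.
near=> y.
have yx : `|y - x| < d by near: y; apply/nbhs_normP; exists d => //= y; rewrite distrC.
have yE : f y = f (x + (y - x)) by rewrite addrC subrK.
have [y1 y2] : `|y - x| < 1 /\ `|y - x| < e / (B - f x + 1).
  by move: yx; rewrite lt_min => /andP.
rewrite yE; apply: le_lt_trans (lip _ y1) _.
rewrite ltr_pdivlMr// in y2; apply: le_lt_trans y2.
by rewrite ler_wpM2l// lerDl.
Unshelve. all: by end_near.
Qed.

End ConvexContinuous.

(** * Continuity and growth of the illumination *)

Section IlluminationLimits.
Context {R : realType} {n : nat} (K : set 'rV[R]_n.+1).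
Hypotheses (cptK : compact K) (cvxK : convex_set K).

Lemma ill_locally_bounded M : exists B, forall x, `|x| <= M -> ill K x <= B.
Proof.
have /compact_bounded/bounded_set_normP[N N0 KN] := cptK.
(* A cube containing [K] and all admissible apexes contains every hull. *)
pose L := Num.max N M.
exists (fine (volume n.+1 (box L))) => x xM.
have NL : N <= L by rewrite le_max lexx.
have ML : M <= L by rewrite le_max lexx orbT.
have L0 : 0 <= L by rewrite (le_trans _ NL)// ltW.
rewrite -lee_fin -volume_join// fineK ?volume_box//.
rewrite -(volume_box n.+1 L0); apply: le_measure; rewrite ?inE.
- exact: measurable_join.
- exact: measurable_box.
move=> _ [k [t [Kk t0 t1 ->]]] i.
have /ler_normlP[k1 k2] := le_trans (normr_coord k i) (le_trans (KN _ Kk) NL).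
have /ler_normlP[x1 x2] := le_trans (normr_coord x i) (le_trans xM ML).
by rewrite !mxE; apply/andP; split; nra.
Qed.

Lemma ill_continuous : continuous (ill K).
Proof.
apply: convex_locally_bounded_continuous; last exact: ill_locally_bounded.
by move=> x y t; exact: ill_convex.
Qed.

(* K and its homothetic copy (K + y)/2 are disjoint parts of the hull once y is far. *)
Lemma ill_gain : exists2 c : R, 0 < c & exists2 D : R, 0 < D & forall k y,
  K k -> D <= `|y - k| -> (1 + c) * fine (volume n.+1 K) <= ill K y.
Proof.
have u2 : (2%:M : 'M[R]_n.+1) \in unitmx.
  by rewrite unitmxE det_scalar unitrX// unitfE pnatr_eq0.
have [c c0 cE] := volume_mulmx u2; exists c => //.
have /compact_bounded/bounded_set_normP[M M0 KM] := cptK.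
(* A common point [w] of the two copies would give |y - k0| <= |2w - y| + |2w| + |k0| <= 4 M, so 8 M
   is far enough. *)
exists (8 * M); first by rewrite mulr_gt0.
move=> k0 y Kk0 yk.
pose H : set 'rV[R]_n.+1 := [set w | K (w *m 2%:M - y)].
have mK := compact_borel cptK.
have mH : measurable (H : set (Borel_Rd R n.+1)) by exact: measurable_preimage_affine.
have mE : measurable ([set w | K (w - y)] : set (Borel_Rd R n.+1)).
  have := measurable_preimage_affine 1%:M (- y) mK.
  by congr measurable; apply/funext => w /=; rewrite mulmx1.
have vH : volume n.+1 H = (c * fine (volume n.+1 K))%:E.
  by rewrite (cE _ mE) (volume_shift (- y) mK) [in LHS](volume_fine cptK).
have KH : K `&` H = set0.
  apply/seteqP; split => // w [Kw Hw].
  have h1 := KM _ Kw; have h2 := KM _ Hw; have h3 := KM _ Kk0.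
  have : `|y - k0| <= `|w *m 2%:M - y| + `|w *m 2%:M| + `|k0|.
    rewrite (_ : y - k0 = - (w *m 2%:M - y) + w *m 2%:M - k0); last first.
      by rewrite opprB subrK.
    by rewrite (le_trans (ler_normB _ _))// lerD2r (le_trans (ler_normD _ _))// normrN.
  rewrite [X in _ + `|X| + _](_ : _ = 2 *: w); last by rewrite mul_mx_scalar.
  rewrite normrZ gtr0_norm// => h4.
  suff : 8 * M <= 4 * M by rewrite ler_pM2r// ler_nat.
  by apply: le_trans yk (le_trans h4 _); lra.
rewrite -lee_fin -volume_join// mulrDl mul1r EFinD -vH -volume_fine//.
rewrite -measureU//; apply: le_measure; rewrite ?inE.
- exact: measurableU.
- exact: measurable_join.
move=> w [Kw|Hw]; first exact: sub_join.
(* [w] is the midpoint of [y] and the point 2w - y of [K]. *)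
exists (w *m 2%:M - y), 2^-1; split => //; first lra.
by rewrite mul_mx_scalar; apply/rowP => i; rewrite !mxE; field.
Qed.

(** At [k] the illumination is the volume of [K]; by convexity along the ray from [k], the fixed
    relative gain c at distance D forces a relative slope of at least c / D beyond. *)
Lemma ill_linear_growth k : K k -> exists2 c : R, 0 < c & exists2 D : R, 0 < D &
  forall y, D <= `|y - k| ->
    (1 + c * `|y - k|) * fine (volume n.+1 K) <= ill K y.
Proof.
move=> Kk; have [c c0 [D D0 gain]] := ill_gain.
exists (c / D); first by rewrite divr_gt0.
exists D => // y Dy.
set r := `|y - k| in Dy *; have r0 : 0 < r by exact: lt_le_trans Dy.
(* This weight gives the point of the segment from [k] to [y] at distance exactly [D] from [k]. *)
pose t := D / r.
have t0 : 0 < t by rewrite divr_gt0.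
have t1 : t <= 1 by rewrite ler_pdivrMr// mul1r.
have := ill_convex cptK cvxK k y (ltW t0) t1.
have : (1 + c) * fine (volume n.+1 K) <= ill K ((1 - t) *: k + t *: y).
  apply: (gain k) => //.
  have -> : (1 - t) *: k + t *: y - k = t *: (y - k).
    by apply/rowP => i; rewrite !mxE; ring.
  by rewrite normrZ gtr0_norm// -/r /t mulfVK// gt_eqF.
move=> h1 h2; have := le_trans h1 h2; rewrite (ill_id cvxK Kk) => h3.
rewrite -(ler_pM2l t0).
have -> : t * ((1 + c / D * r) * fine (volume n.+1 K)) = (t + c) * fine (volume n.+1 K).
  by rewrite /t; field; rewrite !gt_eqF.
lra.
Qed.

End IlluminationLimits.

(** * Dot product, norms and halfspaces *)

Section DotProduct.
Context {R : realType} {n : nat}.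
Implicit Types u x y : 'rV[R]_n.

Lemma dotvE u x : dotv u x = (u *m x^T) ord0 ord0.
Proof. by rewrite mxE; apply: eq_bigr => i _; rewrite mxE. Qed.

Lemma dotvC u x : dotv u x = dotv x u.
Proof. by apply: eq_bigr => i _; rewrite mulrC. Qed.

Lemma dotvDr u x y : dotv u (x + y) = dotv u x + dotv u y.
Proof. by rewrite !dotvE linearD mulmxDr mxE. Qed.

Lemma dotvZr u t x : dotv u (t *: x) = t * dotv u x.
Proof. by rewrite !dotvE linearZ -scalemxAr mxE. Qed.

Lemma dotvZl u t x : dotv (t *: u) x = t * dotv u x.
Proof. by rewrite dotvC dotvZr dotvC. Qed.

Lemma dotvNl u x : dotv (- u) x = - dotv u x.
Proof. by rewrite -scaleN1r dotvZl mulN1r. Qed.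

Lemma dot0v x : dotv 0 x = 0.
Proof. by rewrite -(scale0r 0) dotvZl mul0r. Qed.

Lemma dotv_mulmx u x (A : 'M[R]_n) : dotv u (x *m A^T) = dotv (u *m A) x.
Proof. by rewrite !dotvE trmx_mul trmxK mulmxA. Qed.

Lemma dotv_ge0 x : 0 <= dotv x x.
Proof. by apply: sumr_ge0 => i _; rewrite -expr2 sqr_ge0. Qed.

Lemma sqr_coord_le x i : x ord0 i ^+ 2 <= dotv x x.
Proof.
rewrite /dotv (bigD1 i)//= -expr2 lerDl; apply: sumr_ge0 => j _.
by rewrite -expr2 sqr_ge0.
Qed.

Lemma dotv_eq0 x : (dotv x x == 0) = (x == 0).
Proof.
apply/eqP/eqP => [x0|->]; last exact: dot0v.
apply/rowP => i; rewrite mxE; apply/eqP; rewrite -sqrf_eq0 eq_le sqr_ge0 andbT.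
by rewrite -x0 sqr_coord_le.
Qed.

Lemma normr_le_coord x N : 0 <= N -> (forall i, `|x ord0 i| <= N) -> `|x| <= N.
Proof.
move=> N0 xN; rewrite /Num.norm/= mx_normrE.
by apply/bigmax_leP; split=> // -[i j] _ /=; rewrite ord1.
Qed.

(** [|x|] is the maximum norm, hence dominated by the Euclidean one. *)
Lemma normr_le_dotv x N : 0 <= N -> dotv x x <= N ^+ 2 -> `|x| <= N.
Proof.
move=> N0 xN; apply: normr_le_coord => // i.
rewrite -(ler_pXn2r (n := 2))// ?nnegrE// real_normK ?num_real//.
exact: le_trans (sqr_coord_le _ _) xN.
Qed.

Lemma cvg_dotv (T : Type) (F : set_system T) {FF : Filter F} (f g : T -> 'rV[R]_n) u x :
  f @ F --> u -> g @ F --> x -> dotv (f t) (g t) @[t --> F] --> dotv u x.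
Proof.
move=> fu gx; apply: cvg_big => [|i _]; first exact: add_continuous.
by apply: cvgM; [have := cvg_comp _ _ fu (@coord_continuous R 1 n ord0 i u)
                |have := cvg_comp _ _ gx (@coord_continuous R 1 n ord0 i x)]; exact.
Qed.

Lemma dotv_continuous u : continuous (dotv u).
Proof. by move=> x; apply: (@cvg_dotv _ (nbhs x) _ (fun=> u) id u x (cvg_cst u)); exact: cvg_id. Qed.

Lemma sqnorm_continuous : continuous (fun x => dotv x x).
Proof. by move=> x; apply: (@cvg_dotv _ (nbhs x) _ id id x x); exact: cvg_id. Qed.

Definition halfspace u (c : R) : set 'rV[R]_n := [set y | dotv u y <= c].

Lemma closed_sublevel (f : 'rV[R]_n -> R) c : continuous f -> closed [set y | f y <= c].
Proof.
move=> cf; rewrite (_ : [set y | _] = f @^-1` [set t | t <= c])//.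
by apply: closed_comp; [move=> y _; exact: cf|exact: closed_le].
Qed.

Lemma measurable_sqnorm_ge (c : R) :
  measurable ([set y : 'rV[R]_n | c <= dotv y y] : set (Borel_Rd R n)).
Proof.
apply: closed_borel.
rewrite (_ : [set y | _] = (fun y => dotv y y) @^-1` [set t | c <= t])//.
by apply: closed_comp; [move=> y _; exact: sqnorm_continuous|exact: closed_ge].
Qed.

Lemma measurable_halfspace u c : measurable (halfspace u c : set (Borel_Rd R n)).
Proof. by apply: closed_borel; apply: closed_sublevel; exact: dotv_continuous. Qed.

End DotProduct.

(** * Halfspace depth and central regions *)

Section Depth.
Context {R : realType} {n : nat} (P : probability (Borel_Rd R n) R).
Implicit Types u x y : 'rV[R]_n.
Local Notation HD := (halfspace_depth (probfun P)).

(** The [fine] in the definition loses nothing: the infimum lies between 0 and the value 1 taken in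
    direction 0. *)
Lemma depthE x : (HD x)%:E =
  ereal_inf [set P (halfspace u (dotv u x)) | u in [set: 'rV[R]_n]].
Proof.
rewrite /halfspace_depth fineK// fin_numE; apply/andP; split.
  rewrite gt_eqF//; apply: (@lt_le_trans _ _ 0%E) => //.
  by apply: le_ereal_inf_tmp => _ [u _ <-]; exact: measure_ge0.
rewrite lt_eqF//; apply: (@le_lt_trans _ _ 1%E); last exact: ltry.
apply: ereal_inf_lbound; exists 0 => //; rewrite (_ : [set y | _] = setT); first exact: probability_setT.
by apply/seteqP; split => // y _ /=; rewrite !dot0v.
Qed.

Lemma depth_le u x : ((HD x)%:E <= P (halfspace u (dotv u x)))%E.
Proof. by rewrite depthE; apply: ereal_inf_lbound; exists u. Qed.

Lemma depth_ge a x : (forall u, a%:E <= P (halfspace u (dotv u x)))%E -> a <= HD x.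
Proof. by move=> h; rewrite -lee_fin depthE; apply: le_ereal_inf_tmp => _ [u _ <-]. Qed.

Lemma depth_lt a x : HD x < a -> exists u, (P (halfspace u (dotv u x)) < a%:E)%E.
Proof.
by rewrite -lte_fin depthE => /ereal_inf_lt[_ [u _ <-] ua]; exists u.
Qed.

Lemma depth_ge0 x : 0 <= HD x.
Proof. by apply: depth_ge => u; exact: measure_ge0. Qed.

Lemma halfspace0 x c : 0 <= c -> halfspace 0 c = [set: 'rV[R]_n].
Proof. by move=> c0; apply/seteqP; split => // y _; rewrite /halfspace/= dot0v. Qed.

Lemma prob_halfspace_le u a b : a <= b -> (P (halfspace u a) <= P (halfspace u b))%E.
Proof.
move=> ab; apply: le_measure; rewrite ?inE; try exact: measurable_halfspace.
by move=> y /= /le_trans; apply.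
Qed.

(** A linear functional at a convex combination is at least the smaller of its end values, so the
    halfspace there contains the one bounded at that end. *)
Lemma depth_quasiconcave a x y t : 0 <= t -> t <= 1 -> a <= HD x -> a <= HD y ->
  a <= HD ((1 - t) *: x + t *: y).
Proof.
move=> t0 t1 ax ay; apply: depth_ge => u; rewrite dotvDr !dotvZr.
have [xy|yx] := leP (dotv u x) (dotv u y).
  apply: le_trans (prob_halfspace_le u (_ : dotv u x <= _)); last by nra.
  by apply: le_trans (depth_le u x); rewrite lee_fin.
apply: le_trans (prob_halfspace_le u (_ : dotv u y <= _)); last by nra.
by apply: le_trans (depth_le u y); rewrite lee_fin.
Qed.

Lemma prob_lt_nonincreasing (F : (set (Borel_Rd R n))^nat) a :
  (forall k, measurable (F k)) -> nonincreasing_seq F ->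
  (P (\bigcap_k F k) < a)%E -> exists k, (P (F k) < a)%E.
Proof.
move=> mF ndF Pa.
have cv : P \o F @ \oo --> P (\bigcap_k F k).
  apply: nonincreasing_cvg_mu => //; last exact: bigcapT_measurable.
  by rewrite (le_lt_trans (probability_le1 _ _))// ltry.
have : \forall k \near \oo, (P (F k) < a)%E.
  apply: (cv [set z | (z < a)%E]); apply: open_nbhs_nbhs; split => //; exact: open_ereal_lt_ereal.
by move=> [N _ /(_ N (leqnn N))]; exists N.
Qed.

(** By continuity from above, a halfspace witnessing depth below [a] at [x] can be enlarged
    slightly; it then serves all nearby points. *)
Lemma depth_upper_semicontinuous : upper_semicontinuous HD.
Proof.
move=> x a /depth_lt[u].
rewrite (_ : halfspace _ _ = \bigcap_k halfspace u (dotv u x + k.+1%:R^-1)); last first.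
  apply/seteqP; split => y /= h.
    by move=> k _; rewrite /halfspace/= (le_trans h)// lerDl.
  apply/ler_addgt0Pr => e e0.
  have [k ke] : exists k : nat, k.+1%:R^-1 < e :> R.
    by have /ltr_add_invr[k] := e0; rewrite add0r; exists k.
  by apply: le_trans (h k I) _; rewrite lerD2l ltW.
move=> /prob_lt_nonincreasing[k||k Pk].
- exact: measurable_halfspace.
- move=> i j ij; apply/subsetPset => y /= /le_trans; apply.
  by rewrite lerD2l lef_pV2 ?posrE// ler_nat.
exists [set y | dotv u y < dotv u x + k.+1%:R^-1].
  apply: open_nbhs_nbhs; split; last by rewrite /= ltrDl.
  rewrite (_ : [set y | _] = dotv u @^-1` [set t | t < dotv u x + k.+1%:R^-1])//.
  by apply: open_comp; [move=> ? _; exact: dotv_continuous|exact: open_lt].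
move=> y /= yx; rewrite -lte_fin; apply: le_lt_trans (depth_le u y) (le_lt_trans _ Pk).
exact: prob_halfspace_le (ltW yx).
Qed.

(* [x.y >= x.x] forces [y.y >= x.x], as [2 x.y <= x.x + y.y]. *)
Lemma depth_le_tail x : ((HD x)%:E <= P [set y : 'rV[R]_n | (dotv x x <= dotv y y)%R])%E.
Proof.
apply: le_trans (depth_le (- x) x) _; apply: le_measure; rewrite ?inE.
- exact: measurable_halfspace.
- exact: measurable_sqnorm_ge.
move=> y; rewrite /halfspace/= !dotvNl lerN2 => xy.
have := dotv_ge0 (x - y); rewrite dotvDr -scaleN1r dotvZr !(dotvC (x + _)) !dotvDr !dotvZr (dotvC y x).
by lra.
Qed.

(** The tail events bounding the depth decrease to the empty set, so their probabilities tend to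
    0. *)
Lemma depth_vanishes e : 0 < e -> exists2 M, 0 < M & forall x, M <= dotv x x -> HD x < e.
Proof.
move=> e0.
pose F (k : nat) : set 'rV[R]_n := [set y | k%:R <= dotv y y].
have mF k : measurable (F k : set (Borel_Rd R n)).
  exact: measurable_sqnorm_ge.
have ndF i j : (i <= j)%N -> F j `<=` F i.
  by move=> ij y; apply: le_trans; rewrite ler_nat.
have [||k Pk] := @prob_lt_nonincreasing F e%:E mF.
- by move=> i j ij; apply/subsetPset; exact: ndF.
- rewrite (_ : \bigcap_k F k = set0) ?measure0 ?lte_fin//.
  apply/seteqP; split => // y /(_ (Num.truncn (dotv y y)).+1 I).
  by rewrite /F/= leNgt truncnS_gt.
(* The successor makes the bound positive even for k = 0. *)
exists k.+1%:R => // x xk; rewrite -lte_fin; apply: le_lt_trans (depth_le_tail x) (le_lt_trans _ Pk).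
apply: le_measure; rewrite ?inE//; last first.
  by move=> y /=; apply: le_trans; apply: le_trans xk; rewrite ler_nat.
exact: measurable_sqnorm_ge.
Qed.

Lemma convex_central_region a : convex_set (central_region (probfun P) a).
Proof. by apply/convex_setP => x y t t0 t1 ax ay; exact: depth_quasiconcave. Qed.

Lemma closed_central_region a : closed (central_region (probfun P) a).
Proof.
rewrite -openC openE => x /= /negP; rewrite -ltNge => /depth_upper_semicontinuous[V Vx Va].
by apply: filterS Vx => y /Va; rewrite /= ltNge => /negP.
Qed.

Lemma compact_central_region a : 0 < a -> compact (central_region (probfun P) a).
Proof.
move=> a0; apply: bounded_closed_compact; last exact: closed_central_region.
have [M M0 hM] := depth_vanishes a0.
apply/bounded_set_normP; exists (M + 1); first by rewrite addr_gt0.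
move=> x ax; apply: normr_le_dotv; first by rewrite addr_ge0// ltW.
have : dotv x x <= M.
  by rewrite leNgt; apply/negP => /ltW/hM; rewrite ltNge => /negP; exact.
by move=> /le_trans; apply; rewrite sqrrD1; nra.
Qed.

(** A deeper [z] would yield disjoint opposite halfspaces, bounded at [x] and at [z], of probability
    at least 1/2 and more than 1/2. Hence depth 1/2 already makes a point deepest. *)
Lemma depth_half_deep x z : 1 / 2 <= HD x -> HD x < HD z -> False.
Proof.
move=> x2 /depth_lt[u uz].
have zx : dotv u x < dotv u z.
  rewrite ltNge; apply/negP => /(prob_halfspace_le u) h.
  by have := le_lt_trans (le_trans (depth_le u z) h) uz; rewrite ltxx.
have Px := depth_le u x; have Pz := depth_le (- u) z.
have zhalf : 1 / 2 < HD z.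
  by rewrite -lte_fin; apply: le_lt_trans (le_lt_trans Px uz); rewrite lee_fin.
have := probability_le1 P (measurableU _ _ (measurable_halfspace u (dotv u x))
  (measurable_halfspace (- u) (dotv (- u) z))).
rewrite measureU; [|exact: measurable_halfspace|exact: measurable_halfspace|].
  apply/negP; rewrite -ltNge; apply: lt_le_trans (leeD Px Pz).
  by rewrite -EFinD lte_fin; lra.
apply/seteqP; split => // y []; rewrite /halfspace/= !dotvNl lerN2 => h1 h2.
by have := lt_le_trans zx (le_trans h2 h1); rewrite ltxx.
Qed.

End Depth.

(** * Continuity of the depth under a density *)

Lemma semicontinuous_continuous (R : realType) (T : topologicalType) (f : T -> R) :
  (forall x a, f x < a -> \forall y \near x, f y < a) ->
  (forall x a, a < f x -> \forall y \near x, a < f y) -> continuous f.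
Proof.
move=> usc lsc x; apply/cvgrPdist_lt => e e0.
have up : \forall y \near x, f y < f x + e by apply: usc; rewrite ltrDl.
have lo : \forall y \near x, f x - e < f y by apply: lsc; rewrite ltrBlDr ltrDl.
near=> y; rewrite ltr_norml; apply/andP; split.
  by rewrite ltrNl opprB ltrBlDl; near: y.
by rewrite ltrBlDr -ltrBlDl; near: y.
Unshelve. all: by end_near.
Qed.

Section Density.
Context {R : realType} {n : nat} (P : probability (Borel_Rd R n.+1) R).
Implicit Types u x y : 'rV[R]_n.+1.
Local Notation HD := (halfspace_depth (probfun P)).

Lemma measurable_hyperplane u c :
  measurable ([set y | dotv u y = c] : set (Borel_Rd R n.+1)).
Proof.
apply: closed_borel; rewrite (_ : [set y | _] = dotv u @^-1` [set c])//.
by apply: closed_comp; [move=> y _; exact: dotv_continuous|exact: closed_eq].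
Qed.

(** A line parallel to [u] meets the hyperplane in at most one point, so all chords in that
    direction have length zero. *)
Lemma volume_hyperplane u c : u != 0 -> volume n.+1 [set y | dotv u y = c] = 0%E.
Proof.
move=> u0; have [A uA Au] := line_coordinates u0.
have [k k0 kE] := volume_mulmx uA.
have mH := measurable_hyperplane u c.
have mHA : measurable ([set x | dotv u (x *m A) = c] : set (Borel_Rd R n.+1)).
  have := measurable_preimage_affine A 0 mH.
  by congr measurable; apply/funext => q /=; rewrite addr0.
have : volume n.+1 [set x | dotv u (x *m A) = c] = 0%E.
  rewrite volume_fibre//; apply: integral0_eq => v _.
  apply/eqP; rewrite eq_le measure_ge0 andbT.
  apply: lebesgue_measure_le_diam => //; first exact: measurable_fibre.
  move=> p q; rewrite /fibre/= => hp hq; rewrite lee_fin.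
  have := Au v p (q - p); rewrite [p + _]addrC subrK => E.
  move: hq; rewrite E dotvDr dotvZr hp -[RHS]addr0 => /addrI/eqP.
  by rewrite mulf_eq0 dotv_eq0 (negbTE u0) orbF => /eqP ->.
rewrite (kE _ mH) => /eqP; rewrite mule_eq0 => /orP[|/eqP//].
by rewrite eqe gt_eqF.
Qed.

Lemma density_hyperplane u c : has_density P -> u != 0 ->
  P [set y | dotv u y = c] = 0%E.
Proof.
move=> [f [mf f0 Pf]] u0; have mH := measurable_hyperplane u c.
rewrite Pf//; rewrite (@iter_intE _ n.+1 (fun y => (f y * \1_[set y | dotv u y = c] y)%:E)).
- rewrite (_ : (fun y => _) = ((EFin \o f) \_ [set y | dotv u y = c])); last first.
    apply/funext => y; rewrite patchE indicE; case: ifP => _; first by rewrite mulr1.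
    by rewrite mulr0.
  rewrite -integral_mkcond null_set_integral//.
  + exact/measurable_EFinP/measurable_funTS.
  + exact: volume_hyperplane.
- by apply/measurable_EFinP; apply: measurable_funM => //; exact: measurable_indic.
- by move=> y; rewrite lee_fin mulr_ge0.
Qed.

Lemma prob_gt_nondecreasing (F : (set (Borel_Rd R n.+1))^nat) a :
  (forall k, measurable (F k)) -> nondecreasing_seq F ->
  (a < P (\bigcup_k F k))%E -> exists k, (a < P (F k))%E.
Proof.
move=> mF ndF Pa.
have cv : P \o F @ \oo --> P (\bigcup_k F k).
  by apply: nondecreasing_cvg_mu => //; exact: bigcupT_measurable.
have : \forall k \near \oo, (a < P (F k))%E.
  by apply: (cv [set z | (a < z)%E]); apply: open_nbhs_nbhs; split => //; exact: open_ereal_gt_ereal.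
by move=> [N _ /(_ N (leqnn N))]; exists N.
Qed.

(* The open halfspace is exhausted by the closed sets of points y lying in all
   halfspaces close to the given one. *)
Lemma prob_halfspace_lower_semicontinuous a u x :
  (a < P [set y : 'rV[R]_n.+1 | (dotv u y < dotv u x)%R])%E ->
  \forall u' \near u & x' \near x, (a < P (halfspace u' (dotv u' x')))%E.
Proof.
move=> aP.
pose W (k : nat) : set 'rV[R]_n.+1 := [set y | forall u' x',
  `|u - u'| < k.+1%:R^-1 -> `|x - x'| < k.+1%:R^-1 -> dotv u' y <= dotv u' x'].
have mW k : measurable (W k : set (Borel_Rd R n.+1)).
  apply: closed_borel.
  rewrite (_ : W k = \bigcap_(p in [set p : 'rV[R]_n.+1 * 'rV[R]_n.+1 |
    `|u - p.1| < k.+1%:R^-1 /\ `|x - p.2| < k.+1%:R^-1]) halfspace p.1 (dotv p.1 p.2)).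
    by apply: closed_bigI => p _; apply: closed_sublevel; exact: dotv_continuous.
  apply/seteqP; split => y /= H; first by move=> [u' x'] /= [h1 h2]; exact: H.
  by move=> u' x' h1 h2; exact: (H (u', x')).
have [||k aW] := @prob_gt_nondecreasing W a mW.
- move=> i j ij; apply/subsetPset => y Wy u' x' h1 h2.
  have ji : j.+1%:R^-1 <= i.+1%:R^-1 :> R by rewrite lef_pV2 ?posrE// ler_nat.
  by apply: Wy; [exact: lt_le_trans h1 ji|exact: lt_le_trans h2 ji].
- apply: lt_le_trans aP _; apply: le_measure; rewrite ?inE.
  + apply: open_borel.
    rewrite (_ : [set y | _] = dotv u @^-1` [set t | t < dotv u x])//.
    by apply: open_comp; [move=> ? _; exact: dotv_continuous|exact: open_lt].
  + exact: bigcupT_measurable.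
  move=> y /= yx.
  (* By joint continuity the strict inequality at (u, x) persists for nearby pairs, so [y] lies in
     some [W k]. *)
  have cv : dotv p.1 p.2 - dotv p.1 y @[p --> (u, x)] --> dotv u x - dotv u y.
    apply: cvgB; apply: cvg_dotv; try exact: cvg_fst; try exact: cvg_snd; exact: cvg_cst.
  have : 0 < dotv u x - dotv u y by rewrite subr_gt0.
  move=> /(cvgr_gt _ cv)[[A B] /= [/nbhs_normP[e1 /= e10 uA] /nbhs_normP[e2 /= e20 xB]] AB].
  have e0 : 0 < Num.min e1 e2 by rewrite lt_min e10.
  have /ltr_add_invr[k] := e0; rewrite add0r lt_min => /andP[k1 k2].
  exists k => // u' x' hu hx; rewrite -subr_ge0 ltW//.
  apply: (AB (u', x')); split => /=.
    by apply: uA => /=; exact: lt_trans hu k1.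
  by apply: xB => /=; exact: lt_trans hx k2.
have nb (z : 'rV[R]_n.+1) : nbhs z [set z' | `|z - z'| < k.+1%:R^-1].
  rewrite (_ : [set z' | _] = ball z k.+1%:R^-1); last by rewrite -ball_normE.
  by apply: nbhsx_ballx; rewrite invr_gt0.
exists ([set u' | `|u - u'| < k.+1%:R^-1], [set x' | `|x - x'| < k.+1%:R^-1]) => /=.
  by split; exact: nb.
move=> [u' x'] /= [h1 h2]; apply: lt_le_trans aW _; apply: le_measure; rewrite ?inE//.
  exact: measurable_halfspace.
by move=> y Wy; exact: Wy.
Qed.

Lemma density_depth_lower_semicontinuous x a : has_density P -> a < HD x ->
  \forall x' \near x, a < HD x'.
Proof.
move=> dP ax; pose b := (a + HD x) / 2.
(* Room below [b] is required, since an infimum of values above [b] may equal [b]. *)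
have [ab bx] : a < b /\ b < HD x by rewrite /b; split; lra.
pose S := [set u : 'rV[R]_n.+1 | `|u| = 1].
have cS : compact S.
  apply: bounded_closed_compact; first by apply/bounded_set_normP; exists 1 => // u ->.
  rewrite (_ : S = Num.norm @^-1` [set 1])//.
  by apply: closed_comp; [move=> y _; exact: norm_continuous|exact: closed_eq].
have := proj1 (compact_near_coveringP S) cS _ (nbhs x)
  (fun x' u => b%:E < P (halfspace u (dotv u x')))%E _.
move=> cov.
have {cov} : \forall x' \near x, S `<=` (fun u => b%:E < P (halfspace u (dotv u x')))%E.
  apply: cov => u Su; apply: prob_halfspace_lower_semicontinuous.
  have u0 : u != 0 by apply/eqP => u0; move: Su; rewrite /S/= u0 normr0 => /eqP; rewrite eq_sym oner_eq0.
  have mo : measurable ([set y : 'rV[R]_n.+1 | dotv u y < dotv u x] : set (Borel_Rd R n.+1)).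
    apply: open_borel.
    rewrite (_ : [set y | _] = dotv u @^-1` [set t | t < dotv u x])//.
    by apply: open_comp; [move=> ? _; exact: dotv_continuous|exact: open_lt].
  (* The boundary hyperplane is null, so the open and closed halfspaces have the same
     probability. *)
  have -> : P [set y : 'rV[R]_n.+1 | dotv u y < dotv u x] = P (halfspace u (dotv u x)).
    rewrite (_ : halfspace _ _ = [set y | dotv u y < dotv u x] `|` [set y | dotv u y = dotv u x]).
      rewrite measureU//; last 2 first.
      - exact: measurable_hyperplane.
      - by apply/seteqP; split => // y /= []; move=> + E; rewrite E ltxx.
      by rewrite [X in (_ + X)%E](density_hyperplane _ dP u0) adde0.
    apply/seteqP; split => y; rewrite /halfspace/=.
      by rewrite le_eqVlt => /orP[/eqP|]; [right|left].
    by move=> [/ltW|->].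
  by apply: lt_le_trans (depth_le P u x); rewrite lte_fin.
apply: filterS => x' Sx'; apply: (lt_le_trans ab); apply: depth_ge => u.
(* Direction 0 gives probability 1; any other is normalised to the sphere without changing its
   halfspace. *)
have [->|u0] := eqVneq u 0.
  rewrite dot0v halfspace0// probability_setT lee_fin.
  apply: le_trans (ltW bx) _; rewrite -lee_fin; apply: le_trans (depth_le P 0 x) _.
  by apply: probability_le1; exact: measurable_halfspace.
have nu : 0 < `|u| by rewrite normr_gt0.
have := Sx' (`|u|^-1 *: u); rewrite /S/= normrZ gtr0_norm ?invr_gt0// mulVf ?gt_eqF//.
move=> /(_ erefl)/ltW; rewrite (_ : halfspace (_ *: _) _ = halfspace u (dotv u x'))//.
by apply/funext => y; rewrite /halfspace/= !dotvZl ler_pM2l// invr_gt0.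
Qed.

Lemma density_depth_continuous : has_density P -> continuous HD.
Proof.
move=> dP; apply: semicontinuous_continuous => x a.
  by move=> /depth_upper_semicontinuous[V Vx hV]; apply: filterS Vx => y /hV.
exact: density_depth_lower_semicontinuous.
Qed.

End Density.

(** * Affine maps acting on depth, regions and hulls *)

Section AffineInvariance.
Context {R : realType} {n : nat}.
Implicit Types (mu : set 'rV[R]_n -> \bar R) (A : 'M[R]_n) (b x : 'rV[R]_n).

(** In row form A y + b is y A^T + b. The direction [u] pulls back to u A, and these exhaust all
    directions since [A] is invertible. *)
Lemma depth_affine mu A b x : A \in unitmx ->
  halfspace_depth (law mu (fun y => y *m A^T + b)) (x *m A^T + b) = halfspace_depth mu x.
Proof.
move=> uA; rewrite /halfspace_depth; congr (fine (ereal_inf _)).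
have E u : law mu (fun y => y *m A^T + b) [set y | dotv u y <= dotv u (x *m A^T + b)]
    = mu [set y | dotv (u *m A) y <= dotv (u *m A) x].
  by rewrite /law; congr mu; apply/funext => y /=; rewrite !dotvDr lerD2r !dotv_mulmx.
apply/seteqP; split => [_ [u _ <-]|_ [u _ <-]]; first by exists (u *m A).
by exists (u *m invmx A) => //; rewrite E mulmxKV.
Qed.

Lemma central_region_affine mu A b a : A \in unitmx ->
  central_region (law mu (fun y => y *m A^T + b)) a =
  [set w | central_region mu a ((w - b) *m invmx A^T)].
Proof.
move=> uA; apply/funext => w; rewrite /central_region/=.
by rewrite -(depth_affine mu b ((w - b) *m invmx A^T) uA) mulmxKV ?unitmx_tr// subrK.
Qed.

Lemma convex_preimage_affine (C : set 'rV[R]_n) (B : 'M[R]_n) b : convex_set C ->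
  convex_set [set w : 'rV[R]_n | C ((w - b) *m B)].
Proof.
move=> /convex_setP cC; apply/convex_setP => x y t t0 t1 /= Cx Cy.
rewrite (_ : (_ - b) *m B = (1 - t) *: ((x - b) *m B) + t *: ((y - b) *m B)); first exact: cC.
rewrite !scalemxAl -mulmxDl; congr (_ *m _).
by apply/rowP => i; rewrite !mxE; ring.
Qed.

Lemma join_preimage_affine (C : set 'rV[R]_n) (B : 'M[R]_n) b x : B \in unitmx ->
  join [set w | C ((w - b) *m B)] x = [set w | join C ((x - b) *m B) ((w - b) *m B)].
Proof.
move=> uB.
have E (k : 'rV[R]_n) t : ((1 - t) *: k + t *: x - b) *m B =
    (1 - t) *: ((k - b) *m B) + t *: ((x - b) *m B).
  rewrite !scalemxAl -mulmxDl; congr (_ *m _).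
  by apply/rowP => i; rewrite !mxE; ring.
apply/seteqP; split => w.
  by move=> [k [t [Ck t0 t1 ->]]]; exists ((k - b) *m B), t; split.
move=> [k [t [Ck t0 t1 wE]]]; exists (k *m invmx B + b), t.
have kE : (k *m invmx B + b - b) *m B = k by rewrite addrK mulmxKV.
split => //=; first by rewrite kE.
apply: (can_inj (subrK b)); apply: (can_inj (mulmxK uB)).
by rewrite wE E kE.
Qed.

End AffineInvariance.

(** * The properties of the illumination depth *)

Section IlluminationDepth.
Context {R : realType} {n : nat} (P : probability (Borel_Rd R n.+1) R) (alpha : R).
Hypotheses (alpha_gt0 : 0 < alpha) (alpha_lt : (alpha%:E < max_depth (probfun P))%E).
Hypothesis vol_gt0 : (0 < vol (central_region (probfun P) alpha))%E.
Implicit Types u x y : 'rV[R]_n.+1.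

Local Notation HD := (halfspace_depth (probfun P)).
Local Notation K := (central_region (probfun P) alpha).
Local Notation ID := (illum_depth (probfun P) alpha).

Let v := fine (volume n.+1 K).

Let compactK : compact K. Proof. exact: compact_central_region. Qed.
Let convexK : convex_set K. Proof. exact: convex_central_region. Qed.
Let mK : measurable (K : set (Borel_Rd R n.+1)). Proof. exact: compact_borel. Qed.

Let deep_point : exists z, alpha < HD z.
Proof. by have /ereal_sup_gt[_ [z _ <-]] := alpha_lt; rewrite lte_fin; exists z. Qed.

Let K0 : K !=set0. Proof. by have [z /ltW] := deep_point; exists z. Qed.

Let volK : vol K = v%:E. Proof. by rewrite volE// [LHS](volume_fine compactK). Qed.

Let v0 : 0 < v. Proof. by move: vol_gt0; rewrite volK lte_fin. Qed.

Lemma illum_depthE x : ID x = (HD x, ill K x / v).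
Proof. by rewrite /illum_depth illuminationE// volK. Qed.

(** Region and hull are both transported by the map and their volumes scale by the same positive
    factor, which cancels in the quotient. *)
Lemma illum_depth_affine (A : 'M[R]_n.+1) b x : A \in unitmx ->
  illum_depth (law (probfun P) (fun y => y *m A^T + b)) alpha (x *m A^T + b) = ID x.
Proof.
move=> uA; have uB : invmx A^T \in unitmx by rewrite unitmx_inv unitmx_tr.
have [c c0 cE] := volume_mulmx uB.
have xE : (x *m A^T + b - b) *m invmx A^T = x by rewrite addrK mulmxK// unitmx_tr.
have preE (C : set 'rV[R]_n.+1) : measurable (C : set (Borel_Rd R n.+1)) ->
    vol [set w | C ((w - b) *m invmx A^T)] = (c%:E * volume n.+1 C)%E.
  move=> mC; pose b' := - (b *m invmx A^T).
  have mCb : measurable ([set q | C (q + b')] : set (Borel_Rd R n.+1)).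
    have := measurable_preimage_affine 1%:M b' mC.
    by congr measurable; apply/funext => q /=; rewrite mulmx1.
  have E : [set w | C ((w - b) *m invmx A^T)] = [set w | C (w *m invmx A^T + b')].
    by apply/funext => w /=; rewrite mulmxBl.
  rewrite E volE; last exact: measurable_preimage_affine.
  by rewrite (cE _ mCb) (volume_shift b' mC).
rewrite illum_depthE /illum_depth depth_affine//; congr (_, _).
rewrite central_region_affine// preE//.
rewrite /illumination conv_setU1; last 2 first.
- exact: convex_preimage_affine.
- by have [k Kk] := K0; exists (k *m A^T + b) => /=; rewrite addrK mulmxK// unitmx_tr.
rewrite join_preimage_affine// xE preE; last exact: measurable_join.
rewrite volume_join// (volume_fine compactK) -!EFinM/= -/v.
by field; rewrite !gt_eqF.
Qed.

Lemma halfspace_symmetric_depth x : halfspace_symmetric (probfun P) x <-> 1 / 2 <= HD x.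
Proof.
split=> [sx|x2 u c _ xc].
  apply: depth_ge => u; have [->|u0] := eqVneq u 0.
    by rewrite dot0v halfspace0// probability_setT lee_fin; lra.
  exact: sx.
apply: le_trans (prob_halfspace_le P u xc).
by apply: le_trans (depth_le P u x); rewrite lee_fin.
Qed.

(** Depth 1/2 makes [x] deepest, so [x] lies in the central region and adds no volume. The converse
    reads off the first component. *)
Lemma halfspace_symmetric_illum_depth x : halfspace_symmetric (probfun P) x <->
  exists c : R, 1 / 2 <= c /\ ID x = (c, 1).
Proof.
rewrite halfspace_symmetric_depth illum_depthE; split => [x2|[c [c2 [-> _]]]]//.
exists (HD x); split => //; congr (_, _).
rewrite ill_id ?divff ?gt_eqF//; rewrite /central_region/= leNgt; apply/negP => xa.
by have [z az] := deep_point; exact: (depth_half_deep x2 (lt_trans xa az)).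
Qed.

(** x + s u lies between [x] and x + t u; [x] maximises the quasiconcave depth and, being in the
    central region, minimises the convex illumination. *)
Lemma illum_depth_ray x u s t : (HD x)%:E = max_depth (probfun P) -> 0 <= s -> s <= t ->
  (ID (x + t *: u)).1 <= (ID (x + s *: u)).1 /\ (ID (x + s *: u)).2 <= (ID (x + t *: u)).2.
Proof.
move=> xmax s0 st; have [t0|t0] := eqVneq t 0.
  by have -> : s = t by apply/eqP; rewrite eq_le st t0.
have tp : 0 < t by rewrite lt_neqAle eq_sym t0 (le_trans s0).
have hmax y : HD y <= HD x.
  by rewrite -lee_fin xmax; apply: ereal_sup_ubound; exists y.
have Kx : K x by rewrite /central_region/= -lee_fin xmax ltW.
pose r := s / t.
have r0 : 0 <= r by rewrite divr_ge0// ltW.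
have r1 : r <= 1 by rewrite ler_pdivrMr// mul1r.
have -> : x + s *: u = (1 - r) *: x + r *: (x + t *: u).
  by rewrite scalerDr addrA -scalerDl subrK scale1r scalerA divfK.
rewrite !illum_depthE/=; split; first exact: depth_quasiconcave.
rewrite ler_pM2r ?invr_gt0//; apply: le_trans (ill_convex compactK convexK _ _ r0 r1) _.
have := ill_ge compactK (x + t *: u); rewrite (ill_id convexK Kx).
move: (fine _) (ill _ _) => a b; nra.
Qed.

Lemma illum_depth_level_set c1 c2 :
  let S := [set x | c1 <= (ID x).1 /\ (ID x).2 <= c2] in
  convex_set S /\ (0 < c1 -> compact S).
Proof.
move=> S; have SE : S = central_region (probfun P) c1 `&` [set x | ill K x <= c2 * v].
  have E2 x : ((ID x).2 <= c2) = (ill K x <= c2 * v).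
    by rewrite illum_depthE ler_pdivrMr.
  by apply/seteqP; split => x [h1 h2]; split => //; [have := h2; rewrite E2|rewrite E2].
rewrite SE; split.
  apply/convex_setP => x y t t0 t1 [/= ax bx] [/= ay by']; split.
    exact: depth_quasiconcave.
  apply: le_trans (ill_convex compactK convexK _ _ t0 t1) _; nra.
move=> c10; apply: compact_closedI; first exact: compact_central_region.
by apply: closed_sublevel; exact: ill_continuous.
Qed.

Lemma illum_depth2_continuous : continuous (fun x => (ID x).2).
Proof.
rewrite (_ : (fun x => _) = (fun x => ill K x / v)); last first.
  by apply/funext => x; rewrite illum_depthE.
move=> x; have h := ill_continuous compactK convexK (x := x).
exact: cvgM h (cvg_cst _).
Qed.

Lemma illum_depth_continuous : has_density P -> continuous (fun x => ID x).
Proof.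
move=> dP x.
have h1 := density_depth_continuous dP (x := x).
have h2 := illum_depth2_continuous (x := x).
exact: (cvg_pair h1 h2).
Qed.

(** Nonemptiness keeps the supremum in the limit statement from being -oo. *)
Let far_point (r : R) : exists x, r <= enorm x.
Proof.
exists (const_mx r); apply: le_trans (ler_norm _) _.
rewrite -sqrtr_sqr ler_sqrt ?dotv_ge0//.
by have := sqr_coord_le (const_mx r : 'rV[R]_n.+1) ord0; rewrite mxE.
Qed.

Let enorm_ge_dotv x r : 0 <= r -> r <= enorm x -> r ^+ 2 <= dotv x x.
Proof.
move=> r0 rx; rewrite -(sqr_sqrtr (dotv_ge0 x)).
by rewrite ler_pXn2r// nnegrE ?sqrtr_ge0.
Qed.

Lemma illum_depth1_vanishes :
  ereal_sup [set (ID x).1%:E | x in [set x | r <= enorm x]] @[r --> +oo] --> 0%E.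
Proof.
have lo r : (0 <= ereal_sup [set (ID x).1%:E | x in [set x | (r <= enorm x)%R]])%E.
  have [x rx] := far_point r; apply: le_ereal_sup_tmp; exists (ID x).1%:E; first by exists x.
  by rewrite lee_fin illum_depthE depth_ge0.
have up e : 0 < e -> \forall r \near +oo,
    (ereal_sup [set (ID x).1%:E | x in [set x | (r <= enorm x)%R]] <= e%:E)%E.
  move=> e0; have [M M0 hM] := depth_vanishes P e0.
  near=> r; apply: ge_ereal_sup => _ [x rx <-]; rewrite lee_fin illum_depthE/= ltW//.
  have r1 : 1 <= r by near: r; apply: nbhs_pinfty_ge; exact: num_real.
  apply: hM; apply: le_trans (enorm_ge_dotv _ rx); last by rewrite (le_trans _ r1).
  have : M <= r by near: r; apply: nbhs_pinfty_ge; exact: num_real.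
  by rewrite expr2; nra.
apply/fine_cvgP; split.
  apply: filterS (up 1 ltr01) => r hr; rewrite ge0_fin_numE//.
  exact: le_lt_trans hr (ltry _).
apply/cvgrPdist_le => e e0; apply: filterS (up e e0) => r hr /=.
rewrite sub0r normrN ger0_norm ?fine_ge0// -lee_fin fineK// ge0_fin_numE//.
exact: le_lt_trans hr (ltry _).
Unshelve. all: by end_near.
Qed.

Let dotv_le_norm x : dotv x x <= n.+1%:R * `|x| ^+ 2.
Proof.
rewrite mulr_natl -[X in _ *+ X]card_ord -sumr_const; apply: ler_sum => i _.
rewrite -expr2 -real_normK ?num_real// ler_pXn2r ?nnegrE//.
exact: normr_coord.
Qed.

Lemma illum_depth2_diverges :
  ereal_inf [set (ID x).2%:E | x in [set x | r <= enorm x]] @[r --> +oo] --> +oo%E.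
Proof.
apply/cvgeyPge => A.
have [k Kk] := K0; have [c c0 [D D0 hD]] := ill_linear_growth compactK convexK Kk.
(* Beyond [D] the linear growth applies, and from A / c on it exceeds [A]. *)
pose L := Num.max D (A / c).
have L0 : 0 < L by rewrite lt_max D0.
near=> r; apply: le_ereal_inf_tmp => _ [x rx <-]; rewrite lee_fin illum_depthE/=.
have r1 : 1 <= r by near: r; apply: nbhs_pinfty_ge; exact: num_real.
(* Threshold from comparing the Euclidean and maximum norms: |x - k| < L would give r <= r ^ 2 <= (n
   + 1) (L + |k|) ^ 2 < r. *)
have rL : n.+1%:R * (L + `|k|) ^+ 2 < r by near: r; apply: nbhs_pinfty_gt; exact: num_real.
have Lx : L <= `|x - k|.
  rewrite leNgt; apply/negP => xL.
  have r0 : 0 <= r by rewrite (le_trans _ r1).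
  have h1 := le_trans (enorm_ge_dotv r0 rx) (dotv_le_norm x).
  have h2 : `|x| <= L + `|k|.
    by rewrite -[x in `|x|](subrK k) (le_trans (ler_normD _ _))// lerD2r ltW.
  have h3 : n.+1%:R * `|x| ^+ 2 <= n.+1%:R * (L + `|k|) ^+ 2.
    by rewrite ler_pM2l// ler_pXn2r ?nnegrE// addr_ge0// ltW.
  have := le_lt_trans (le_trans h1 h3) rL; rewrite ltNge => /negP; apply.
  by rewrite expr2; nra.
have [DL AL] : D <= L /\ A / c <= L by rewrite /L !le_max !lexx orbT.
rewrite ler_pdivlMr//; apply: le_trans (hD _ (le_trans DL Lx)).
rewrite ler_pM2r//.
have : A <= c * `|x - k| by rewrite mulrC -ler_pdivrMr// (le_trans AL).
lra.
Unshelve. all: by end_near.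
Qed.

End IlluminationDepth.

Theorem theorem1 (R : realType) (d : nat) (P : probability (Borel_Rd R d) R)
  (alpha : R) :
  (0 < d)%N ->
  0 < alpha -> (alpha%:E < max_depth (probfun P))%E ->
  (0 < vol (central_region (probfun P) alpha))%E ->
  (* (i) affine invariance *)
   (forall (A : 'M[R]_d) (b x : 'rV[R]_d), A \in unitmx ->
      illum_depth (law (probfun P) (fun y => y *m A^T + b)) alpha (x *m A^T + b)
      = illum_depth (probfun P) alpha x) /\
   (* (ii) halfspace symmetry *)
   (forall x : 'rV[R]_d, halfspace_symmetric (probfun P) x <->
      exists c : R, 1/2 <= c /\ illum_depth (probfun P) alpha x = (c, 1)) /\
   (* (iii) monotonicity along rays from a deepest point *)
   (forall x : 'rV[R]_d, (halfspace_depth (probfun P) x)%:E = max_depth (probfun P) ->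
      forall (u : 'rV[R]_d) (s t : R), 0 <= s -> s <= t ->
        (illum_depth (probfun P) alpha (x + t *: u)).1
          <= (illum_depth (probfun P) alpha (x + s *: u)).1 /\
        (illum_depth (probfun P) alpha (x + s *: u)).2
          <= (illum_depth (probfun P) alpha (x + t *: u)).2) /\
   (* (iv) convexity / compactness of level sets *)
   (forall c1 c2 : R,
      let S := [set x : 'rV[R]_d | c1 <= (illum_depth (probfun P) alpha x).1 /\
                                   (illum_depth (probfun P) alpha x).2 <= c2] in
      convex_set S /\ (0 < c1 -> compact S)) /\
   (* (v) semicontinuity / continuity *)
   [/\ upper_semicontinuous (fun x => (illum_depth (probfun P) alpha x).1),
       continuous (fun x : 'rV[R]_d => (illum_depth (probfun P) alpha x).2) &
       (has_density P -> continuous (fun x : 'rV[R]_d => illum_depth (probfun P) alpha x))] /\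
   (* (vi) behaviour at infinity *)
   (ereal_sup [set (illum_depth (probfun P) alpha x).1%:E | x in [set x | r <= enorm x]]
      @[r --> +oo] --> 0%E) /\
   (ereal_inf [set (illum_depth (probfun P) alpha x).2%:E | x in [set x | r <= enorm x]]
      @[r --> +oo] --> +oo%E).
Proof.
case: d P => // n P _ alpha_gt0 alpha_lt vol_gt0; do !split.
- by move=> A b x; exact: illum_depth_affine.
- by move/(halfspace_symmetric_illum_depth alpha_gt0 alpha_lt vol_gt0).
- by move/(halfspace_symmetric_illum_depth alpha_gt0 alpha_lt vol_gt0).
- by apply: (proj1 (illum_depth_ray _ _ _ _ _ _ _)).
- by apply: (proj2 (illum_depth_ray _ _ _ _ _ _ _)).
- exact: (proj1 (illum_depth_level_set _ _ _ _ _)).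
- exact: (proj2 (illum_depth_level_set _ _ _ _ _)).
- exact: depth_upper_semicontinuous.
- exact: illum_depth2_continuous.
- exact: illum_depth_continuous.
- exact: illum_depth1_vanishes.
- exact: illum_depth2_diverges.
Qed.
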